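(* There exists a universal constant $\mathcal{C}>0$ such that the following holds. Let $A$ be a real $m\times n$ matrix with columns $A_1,\dots,A_n$ and let $b\in\mathbb{R}^m$ be such that $b\notin\mathrm{cone}(A)$, where $b$ and all the columns $A_j$ have unit Euclidean norm. Let $\Delta>0$ be a lower bound on $d=\min_{x\in\mathrm{cone}(A)}\|b-x\|$, i.e. $0<\Delta\le d$. Then for any $$0<\varepsilon<\frac{\Delta^2}{\mu_A^2+2\mu_A\sqrt{1-\Delta^2}+1}$$ and any $k\times m$ random projector $T$, $$\mathrm{Prob}\big(Tb\notin\mathrm{cone}(TA)\big)\ \ge\ 1-2(n+1)(n+2)\,e^{-\mathcal{C}(\varepsilon^2-\varepsilon^3)k}.$$
   Context: All norms $\|\cdot\|$ are Euclidean. For a matrix $B$ with columns $B_1,\dots,B_n$, $\mathrm{cone}(B)=\{\sum_{j=1}^n\lambda_jB_j\mid\lambda\ge0\}$. For $x\in\mathrm{cone}(A)$, the $A$-norm of $x$ is $\|x\|_A=\min\{\sum_{j=1}^n\lambda_j\mid\lambda\ge0,\ x=\sum_{j=1}^n\lambda_jA_j\}$, and $\mu_A=\max\{\|x\|_A\mid x\in\mathrm{cone}(A),\ \|x\|\le1\}$. A $k\times m$ random projector is a random $k\times m$ real matrix $T$ of one of the following four types: (1) $T=\sqrt{m/k}$ times the orthogonal projection of $\mathbb{R}^m$ onto a uniformly random $k$-dimensional linear subspace ($k\le m$), written as a $k\times m$ matrix using an orthonormal basis of the subspace; (2) $T=\frac{1}{\sqrt{k}}U$ with $U$ having independent standard normal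 entries; (3) $T=\frac{1}{\sqrt{k}}U$ with $U$ having independent entries equal to $+1$ or $-1$ with probability $\frac12$ each; (4) $T=\sqrt{3/k}\,U$ with $U$ having independent entries equal to $+1,0,-1$ with probabilities $\frac16,\frac23,\frac16$. In all cases $\mathbb{E}\|Ty\|^2=\|y\|^2$ for every $y\in\mathbb{R}^m$. *)

(* Defs.v *)
From HB Require Import structures.
From mathcomp Require Import all_boot all_order all_algebra.
From mathcomp Require Import all_classical all_reals all_analysis.

Set Implicit Arguments.
Unset Strict Implicit.
Unset Printing Implicit Defensive.

Import Order.TTheory GRing.Theory Num.Theory.
Import numFieldNormedType.Exports.

Local Open Scope classical_set_scope.
Local Open Scope ring_scope.

Section Geometry.
Context {R : realType}.

(* The norm `|x| that MathComp-Analysis puts on matrices is the max norm. *)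
Definition enorm m (x : 'cV[R]_m) : R := Num.sqrt (\sum_i x i 0 ^+ 2).

Definition cone m n (B : 'M[R]_(m, n)) : set 'cV[R]_m :=
  [set x | exists lambda : 'I_n -> R,
     (forall j, 0 <= lambda j) /\ x = \sum_j lambda j *: col j B].

(* In the next three definitions the infimum, resp. the supremum, is attained
   whenever x \in cone A, so it is the minimum, resp. the maximum: a linear
   program that is feasible and bounded below has an optimal solution, cone A
   is closed, and Anorm A is continuous on it.
   Outside cone A the value of Anorm A is inf set0 = 0; it is never used. *)
Definition Anorm m n (A : 'M[R]_(m, n)) (x : 'cV[R]_m) : R :=
  inf [set s | exists lambda : 'I_n -> R,
     [/\ forall j, 0 <= lambda j, x = \sum_j lambda j *: col j A
       & s = \sum_j lambda j]].

Definition mu m n (A : 'M[R]_(m, n)) : R :=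
  sup [set Anorm A x | x in [set x | cone A x /\ enorm x <= 1]].

Definition dist_cone m n (A : 'M[R]_(m, n)) (b : 'cV[R]_m) : R :=
  inf [set enorm (b - x) | x in cone A].

End Geometry.

Section RandomProjectors.
Context {d : measure_display} {Omega : measurableType d} {R : realType}.
Variable P : probability Omega R.

Definition mutually_independent (I : finType) (X : I -> {RV P >-> R}) : Prop :=
  forall (J : {set I}) (B : I -> set R), (forall i, measurable (B i)) ->
    P (\bigcap_(i in [set` J]) X i @^-1` B i)
    = (\prod_(i in J) P (X i @^-1` B i))%E.

Definition random_matrix k m (X : Omega -> 'M[R]_(k, m)) : Prop :=
  forall i j, measurable_fun [set: Omega] (fun w => X w i j).

Definition same_law k m (X Y : Omega -> 'M[R]_(k, m)) : Prop :=
  forall B : set 'M[R]_(k, m), <<s open >> B -> P (X @^-1` B) = P (Y @^-1` B).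

(* If the rows of Q w are orthonormal, (Q w)^T *m Q w is the orthogonal
   projection of R^m onto the row space of Q w, and it determines that
   subspace. Moving the subspace by O conjugates the projection by O. The
   uniform law on k-dimensional subspaces is the unique law that is invariant
   under all orthogonal maps. The law of the basis Q w inside the subspace is free. *)
Definition uniform_row_space k m (Q : Omega -> 'M[R]_(k, m)) : Prop :=
  forall O : 'M[R]_m, O *m O^T = 1%:M ->
    same_law (fun w => (Q w)^T *m Q w)
             (fun w => O *m ((Q w)^T *m Q w) *m O^T).

Definition subspace_projector k m (T : Omega -> 'M[R]_(k, m)) : Prop :=
  (k <= m)%N /\
  exists Q : Omega -> 'M[R]_(k, m),
    [/\ random_matrix Q,
        forall w, Q w *m (Q w)^T = 1%:M,
        uniform_row_space Q
      & forall w, T w = Num.sqrt (m%:R / k%:R) *: Q w].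

Definition scaled_independent_entries k m (c : R)
    (entry_law : {RV P >-> R} -> Prop) (T : Omega -> 'M[R]_(k, m)) : Prop :=
  exists U : 'I_k * 'I_m -> {RV P >-> R},
    [/\ mutually_independent U,
        forall ij, entry_law (U ij)
      & forall w, T w = c *: \matrix_(i, j) U (i, j) w].

Definition standard_normal (X : {RV P >-> R}) : Prop :=
  forall B : set R, measurable B -> P (X @^-1` B) = normal_prob 0 1 B.

Definition symmetric_sign (X : {RV P >-> R}) : Prop :=
  P (X @^-1` [set 1]) = (1 / 2)%:E /\ P (X @^-1` [set (- 1)]) = (1 / 2)%:E.

Definition sparse_sign (X : {RV P >-> R}) : Prop :=
  [/\ P (X @^-1` [set 1]) = (1 / 6)%:E,
      P (X @^-1` [set 0]) = (2 / 3)%:E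
    & P (X @^-1` [set (- 1)]) = (1 / 6)%:E].

Definition random_projector k m (T : Omega -> 'M[R]_(k, m)) : Prop :=
  [\/ subspace_projector T,
      scaled_independent_entries (1 / Num.sqrt k%:R) standard_normal T,
      scaled_independent_entries (1 / Num.sqrt k%:R) symmetric_sign T
    | scaled_independent_entries (Num.sqrt (3 / k%:R)) sparse_sign T].

End RandomProjectors.

(* Main.v *)
(* A vector T b in cone (T A) gives x in cone A with T (b - x) = 0, where b - x
   is a combination of b and the columns of A whose coefficients have absolute
   sum at most 1 + mu |x|. If T preserves the inner products of these n + 1
   vectors up to eps, then |b - x|^2 <= eps (1 + mu |x|)^2. On the other hand
   (b, x) <= sqrt (1 - Delta^2) |x|, and a Gram determinant identity then bounds
   |b - x|^2 / (1 + mu |x|)^2 from below by the quantity that eps is less than.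

   T preserves inner products by concentration of |T y|^2. For independent
   entries, each coordinate of T y is sub-Gaussian, and its square has a moment
   generating function close to that of its mean. For subspaces, invariance
   makes E (y^T Pi y)^p = M_p |y|^(2p) for the random projection Pi of rank k;
   comparing the coefficients of t^2 at y + t e_i and summing over i yields
   (k + 2p) M_p = (m + 2p) M_(p+1), and Markov's inequality applied to these
   moments of Pi and of 1 - Pi gives both tails. *)

Require Import Defs.
From HB Require Import structures.
From mathcomp Require Import all_boot all_order all_algebra.
From mathcomp Require Import all_classical all_reals all_analysis.
From mathcomp Require Import measurable_realfun.
From mathcomp Require Import ring lra.

Set Implicit Arguments.
Unset Strict Implicit.
Unset Printing Implicit Defensive.

Import Order.TTheory GRing.Theory Num.Theory.
Import numFieldNormedType.Exports.

Local Open Scope classical_set_scope.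
Local Open Scope ring_scope.

(** * Conic combinations *)

Section Euclidean.
Context {R : realType}.

(** No minimum or maximum is shown to be attained. [mu] only has to be the supremum of a bounded
    set, which rests on a finite-dimensional bound for conic coefficients, and the [A]-norm of a
    vector is approached up to a slack that is removed at the end. The event of the conclusion hides
    an uncountable existential over coefficients, so its measurability is a result in itself:
    rational approximation combined with compactness of a box.

    The combination sent to 0 by T has nonnegative coefficients, so lower bounds on the inner
    products of the images suffice; each of them costs two one-sided tail events.

    The three laws with independent entries share one argument, whose only inputs are a sub-Gaussian
    parameter and a variance. The rate 2^-17 obtained there is crude but absolute, and the subspace
    projectors are weakened to it. For subspaces no model of the uniform law is built: invariance
    under orthogonal maps is all that is used. *)

Definition dotp m (x y : 'cV[R]_m) : R := (x^T *m y) 0 0.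

Lemma dotpE m (x y : 'cV[R]_m) : dotp x y = \sum_i x i 0 * y i 0.
Proof. by rewrite /dotp mxE; apply: eq_bigr => i _; rewrite mxE. Qed.

Lemma dotpC m (x y : 'cV[R]_m) : dotp x y = dotp y x.
Proof. by rewrite !dotpE; apply: eq_bigr => i _; rewrite mulrC. Qed.

Lemma dotpDl m (x y z : 'cV[R]_m) : dotp (x + y) z = dotp x z + dotp y z.
Proof. by rewrite /dotp linearD mulmxDl mxE. Qed.

Lemma dotpDr m (x y z : 'cV[R]_m) : dotp z (x + y) = dotp z x + dotp z y.
Proof. by rewrite /dotp mulmxDr mxE. Qed.

Lemma dotpNl m (x z : 'cV[R]_m) : dotp (- x) z = - dotp x z.
Proof. by rewrite /dotp linearN mulNmx mxE. Qed.

Lemma dotpNr m (x z : 'cV[R]_m) : dotp z (- x) = - dotp z x.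
Proof. by rewrite /dotp mulmxN mxE. Qed.

Lemma dotpZl m a (x z : 'cV[R]_m) : dotp (a *: x) z = a * dotp x z.
Proof. by rewrite /dotp linearZ /= -scalemxAl mxE. Qed.

Lemma dotpZr m a (x z : 'cV[R]_m) : dotp z (a *: x) = a * dotp z x.
Proof. by rewrite /dotp -scalemxAr mxE. Qed.

Lemma dotp0r m (z : 'cV[R]_m) : dotp z 0 = 0.
Proof. by rewrite /dotp mulmx0 mxE. Qed.

Lemma dotp_ge0 m (x : 'cV[R]_m) : 0 <= dotp x x.
Proof. by rewrite dotpE sumr_ge0 // => i _; rewrite -expr2 sqr_ge0. Qed.

Lemma enorm_sqr m (x : 'cV[R]_m) : enorm x ^+ 2 = dotp x x.
Proof.
rewrite sqr_sqrtr; last by apply: sumr_ge0 => i _; exact: sqr_ge0.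
by rewrite dotpE; apply: eq_bigr => i _; rewrite expr2.
Qed.

Lemma enormE m (x : 'cV[R]_m) : enorm x = Num.sqrt (dotp x x).
Proof. by rewrite -enorm_sqr sqrtr_sqr ger0_norm // sqrtr_ge0. Qed.

Lemma enorm_ge0 m (x : 'cV[R]_m) : 0 <= enorm x.
Proof. exact: sqrtr_ge0. Qed.

Lemma dotp_eq0 m (x : 'cV[R]_m) : dotp x x = 0 -> x = 0.
Proof.
rewrite dotpE => /eqP; rewrite psumr_eq0 => [/allP h|i _]; last first.
  by rewrite -expr2 sqr_ge0.
apply/colP => i; have := h i (mem_index_enum i).
by rewrite mxE mulf_eq0 orbb => /eqP.
Qed.

Lemma enorm0 m : enorm (0 : 'cV[R]_m) = 0.
Proof. by rewrite enormE dotp0r sqrtr0. Qed.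

Lemma enorm_gt0 m (x : 'cV[R]_m) : x != 0 -> 0 < enorm x.
Proof.
move=> x0; rewrite lt_neqAle enorm_ge0 andbT eq_sym; apply: contra x0 => /eqP h.
by apply/eqP/dotp_eq0; rewrite -enorm_sqr h expr0n.
Qed.

Lemma enormZ m a (x : 'cV[R]_m) : 0 <= a -> enorm (a *: x) = a * enorm x.
Proof.
move=> a0; rewrite !enormE dotpZl dotpZr mulrA -expr2 sqrtrM ?sqr_ge0 //.
by rewrite sqrtr_sqr ger0_norm.
Qed.

Lemma ler_norm_enorm m (x : 'cV[R]_m) i : `|x i 0| <= enorm x.
Proof.
rewrite -sqrtr_sqr /enorm ler_wsqrtr // (bigD1 i) //= lerDl.
by apply: sumr_ge0 => j _; exact: sqr_ge0.
Qed.

Lemma coneP m n (A : 'M[R]_(m, n)) x :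
  cone A x <-> exists l : 'cV[R]_n, (forall j, 0 <= l j 0) /\ x = A *m l.
Proof.
split=> [[l [l0 ->]]|[l [l0 ->]]].
  exists (\col_j l j); split=> [j|]; first by rewrite mxE.
  apply/colP => i; rewrite summxE mxE; apply: eq_bigr => j _.
  by rewrite !mxE mulrC.
exists (fun j => l j 0); split=> //.
apply/colP => i; rewrite summxE mxE; apply: eq_bigr => j _.
by rewrite !mxE mulrC.
Qed.

End Euclidean.

(** * Bounds on the coefficients of conic combinations *)

Section ConicRepresentations.
Context {R : realType}.

(** Stacking under [A] the diagonal matrix [D] that reads the coordinates outside [J] gives a matrix
    injective on the whole space. The left block of a left inverse recovers [l] from [A *m l], and
    [K] is the sum of the absolute values of its entries. *)
Lemma injective_mx_sum_bound m n (A : 'M[R]_(m, n)) (J : {set 'I_n}) :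
    (forall c : 'cV[R]_n, A *m c = 0 -> (forall j, j \notin J -> c j 0 = 0) ->
       c = 0) ->
  exists2 K : R, 0 <= K & forall l : 'cV[R]_n,
    (forall j, j \notin J -> l j 0 = 0) -> \sum_j l j 0 <= K * enorm (A *m l).
Proof.
move=> inj; pose D : 'M[R]_n := diag_mx (\row_j (j \notin J)%:R).
have DE (l : 'cV[R]_n) j : (D *m l) j 0 = (j \notin J)%:R * l j 0.
  by rewrite mul_diag_mx !mxE.
pose B := col_mx A D.
have : row_free B^T.
  apply: inj_row_free => v vB; apply: trmx_inj; rewrite trmx0.
  have : B *m v^T = 0 by rewrite -[B]trmxK -trmx_mul vB trmx0.
  rewrite mul_col_mx -col_mx0 => /eq_col_mx[Av Dv]; apply: inj => // j jJ.
  have := congr1 (fun M : 'cV_n => M j 0) Dv.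
  by rewrite DE jJ mul1r [in RHS]mxE.
move=> /row_freeP[L' BL]; pose L := L'^T.
have LB : L *m B = 1%:M by rewrite /L -[B]trmxK -trmx_mul BL trmx1.
exists (\sum_j \sum_i `|lsubmx L j i|).
  by apply: sumr_ge0 => j _; apply: sumr_ge0.
move=> l lJ.
have D0 : D *m l = 0.
  by apply/colP => j; rewrite DE mxE; case: (boolP (j \in J)) => [_|/lJ ->];
     rewrite ?mul0r ?mulr0.
have lE : lsubmx L *m (A *m l) = l.
  rewrite -[RHS]mul1mx -LB -[L in RHS]hsubmxK mul_row_col mulmxDl -!mulmxA D0.
  by rewrite mulmx0 addr0.
rewrite -[in leLHS]lE mulr_suml ler_sum // => j _; rewrite mxE mulr_suml ler_sum // => i _.
by rewrite (le_trans (ler_norm _)) // normrM ler_wpM2l // ler_norm_enorm.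
Qed.

(* Carathéodory's argument: a linear relation among the columns lets one move
   a nonnegative combination until one of its coefficients vanishes. *)
Lemma drop_dependent_column m n (A : 'M[R]_(m, n)) (J : {set 'I_n})
    (c l : 'cV[R]_n) (j0 : 'I_n) :
    A *m c = 0 -> (forall j, j \notin J -> c j 0 = 0) -> 0 < c j0 0 ->
    (forall j, 0 <= l j 0) -> (forall j, j \notin J -> l j 0 = 0) ->
  exists2 j1, j1 \in J & exists l' : 'cV[R]_n,
    [/\ forall j, 0 <= l' j 0, forall j, j \notin J :\ j1 -> l' j 0 = 0
      & A *m l' = A *m l].
Proof.
move=> Ac cJ cj0 l0 lJ.
case: (@Order.TotalTheory.arg_minP _ _ 'I_n j0 (fun j => 0 < c j 0)
  (fun j => l j 0 / c j 0) cj0) => j1 cj1 jmin.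
exists j1; first by apply: contraTT cj1 => /cJ ->; rewrite ltxx.
exists (l - (l j1 0 / c j1 0) *: c); split.
- move=> j; rewrite !mxE subr_ge0.
  have t0 : 0 <= l j1 0 / c j1 0 by rewrite divr_ge0 // ltW.
  case: (ltP 0 (c j 0)) => cj; last by rewrite (le_trans _ (l0 j)) // mulr_ge0_le0.
  by rewrite -ler_pdivlMr // jmin.
- move=> j; rewrite !inE negb_and negbK !mxE => /orP[/eqP ->|jJ].
    by rewrite divfK ?subrr // gt_eqF.
  by rewrite (cJ _ jJ) (lJ _ jJ) mulr0 subr0.
- by rewrite mulmxBr -scalemxAr Ac scaler0 subr0.
Qed.

(** Induction on the size of the allowed support. A kernel vector supported in [J], with its sign
    chosen to give it a positive coordinate, lets one column be dropped; which column depends on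
    [l], so the constants of all possible choices are summed. Without such a vector [A] is injective
    on [J]. *)
Lemma conic_sum_bound m n (A : 'M[R]_(m, n)) (J : {set 'I_n}) :
  exists2 K : R, 0 <= K & forall l : 'cV[R]_n,
    (forall j, 0 <= l j 0) -> (forall j, j \notin J -> l j 0 = 0) ->
  exists l' : 'cV[R]_n, [/\ forall j, 0 <= l' j 0, A *m l' = A *m l
    & \sum_j l' j 0 <= K * enorm (A *m l)].
Proof.
elim: {J}_.+1 {-2}J (ltnSn #|J|) => // N IH J JN.
have [[c [c0 Ac cJ]]|noc] := pselect (exists c : 'cV[R]_n,
  [/\ exists j, 0 < c j 0, A *m c = 0 & forall j, j \notin J -> c j 0 = 0]).
- have [j0 cj0] := c0.
  have /choice[K KP] : forall j, exists K : R, 0 <= K /\ (j \in J ->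
      forall l : 'cV[R]_n, (forall j, 0 <= l j 0) ->
      (forall i, i \notin J :\ j -> l i 0 = 0) ->
      exists l' : 'cV[R]_n, [/\ forall j, 0 <= l' j 0, A *m l' = A *m l
        & \sum_j l' j 0 <= K * enorm (A *m l)]).
    move=> j; case: (boolP (j \in J)) => jJ; last by exists 0.
    have [|K K0 KP] := IH (J :\ j); last by exists K.
    by move: JN; rewrite (cardsD1 j) jJ.
  exists (\sum_j K j) => [|l l0 lJ].
    by apply: sumr_ge0 => j _; case: (KP j).
  have [j1 j1J [l1 [l10 l1J Al1]]] := drop_dependent_column Ac cJ cj0 l0 lJ.
  have [l' [l'0 Al' sl']] := (KP j1).2 j1J l1 l10 l1J.
  exists l'; split; rewrite ?Al' //; rewrite -Al1 (le_trans sl') //.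
  rewrite ler_wpM2r ?enorm_ge0 // (bigD1 j1) //= lerDl.
  by apply: sumr_ge0 => j _; case: (KP j).
- have [|K K0 KP] := @injective_mx_sum_bound m n A J; last first.
    by exists K => // l l0 lJ; exists l; split=> //; exact: KP.
  move=> c Ac cJ; apply/colP => j; rewrite mxE; apply/eqP.
  case: ltgtP => // cj; exfalso; apply: noc; last first.
    by exists c; split=> //; exists j.
  exists (- c); split; first by exists j; rewrite mxE oppr_gt0.
    by rewrite mulmxN Ac oppr0.
  by move=> i /cJ; rewrite mxE => ->; rewrite oppr0.
Qed.

End ConicRepresentations.

Section ANorm.
Context {R : realType}.
Variables (m n : nat) (A : 'M[R]_(m, n)).

Let reps (x : 'cV[R]_m) := [set s : R | exists lambda : 'I_n -> R,
     [/\ forall j, 0 <= lambda j, x = \sum_j lambda j *: col j A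
       & s = \sum_j lambda j]].

Let repsP x s : reps x s <-> exists l : 'cV[R]_n,
  [/\ forall j, 0 <= l j 0, x = A *m l & s = \sum_j l j 0].
Proof.
have E (l : 'I_n -> R) : \sum_j l j *: col j A = A *m \col_j l j.
  apply/colP => i; rewrite summxE mxE; apply: eq_bigr => j _.
  by rewrite !mxE mulrC.
split=> [[l [l0 -> ->]]|[l [l0 -> ->]]].
  exists (\col_j l j); split=> [j||]; rewrite ?mxE ?E //.
  by apply: eq_bigr => j _; rewrite mxE.
exists (fun j => l j 0); split; rewrite ?E //.
by congr (_ *m _); apply/colP => j; rewrite mxE.
Qed.

Let reps_ge0 x : lbound (reps x) 0.
Proof. by move=> s /repsP[l [l0 _ ->]]; apply: sumr_ge0. Qed.

Lemma Anorm_ge0 x : 0 <= Anorm A x.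
Proof.
have [r0|/set0P r0] := eqVneq (reps x) set0; last exact: lb_le_inf r0 (@reps_ge0 x).
by rewrite /Anorm -/(reps x) r0 inf0.
Qed.

Let has_inf_reps (l : 'cV[R]_n) : (forall j, 0 <= l j 0) -> has_inf (reps (A *m l)).
Proof.
by move=> l0; split; [exists (\sum_j l j 0); apply/repsP; exists l | exists 0].
Qed.

Lemma Anorm_le (l : 'cV[R]_n) : (forall j, 0 <= l j 0) -> Anorm A (A *m l) <= \sum_j l j 0.
Proof.
by move=> l0; apply: ge_inf; [case: (has_inf_reps l0) | apply/repsP; exists l].
Qed.

(** Boundedness is what gives [mu] its meaning, since [sup] of an unbounded set is a default value.
    The bound is the constant of [conic_sum_bound] for the full set of columns. *)
Lemma has_sup_mu :
  has_sup [set Anorm A x | x in [set x | cone A x /\ enorm x <= 1]].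
Proof.
split.
  exists (Anorm A 0); exists 0 => //; split; last by rewrite enorm0 ler01.
  by apply/coneP; exists 0; split=> [j|]; rewrite ?mxE ?mulmx0.
have [K K0 KP] := conic_sum_bound A [set: 'I_n].
exists K => s [x [/coneP[l [l0 ->]] Al1] <-].
have [|l' [l'0 Al' sl']] := KP l l0; first by move=> j; rewrite inE.
by rewrite -Al' (le_trans (Anorm_le l'0)) // (le_trans sl') // ler_piMr.
Qed.

Lemma mu_ge0 : 0 <= mu A.
Proof.
apply: le_trans (Anorm_ge0 0) _; apply: ub_le_sup; first by case: has_sup_mu.
exists 0 => //; split; last by rewrite enorm0 ler01.
by apply/coneP; exists 0; split=> [j|]; rewrite ?mxE ?mulmx0.
Qed.

(** The slack [e] stands in for attainment of the infimum: an [e / enorm x]-optimal representation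
    of the normalized vector is scaled back by [enorm x]. *)
Lemma cone_representation x (e : R) : 0 < e -> cone A x ->
  exists l : 'cV[R]_n, [/\ forall j, 0 <= l j 0, x = A *m l
    & \sum_j l j 0 <= mu A * enorm x + e].
Proof.
move=> e0 /coneP[l [l0 xE]]; have [x0|x0] := eqVneq x 0.
  exists 0; split=> [j||]; rewrite ?mxE ?mulmx0 //.
  rewrite big1 => [|j _]; last by rewrite mxE.
  by rewrite addr_ge0 ?(ltW e0) // mulr_ge0 ?mu_ge0 ?enorm_ge0.
have nx := enorm_gt0 x0; pose y : 'cV[R]_m := (enorm x)^-1 *: x.
have yl : y = A *m ((enorm x)^-1 *: l) by rewrite -scalemxAr -xE.
have l'0 j : 0 <= ((enorm x)^-1 *: l) j 0.
  by rewrite mxE mulr_ge0 // invr_ge0 ltW.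
have cy : cone A y by apply/coneP; exists ((enorm x)^-1 *: l).
have ny : enorm y = 1.
  by rewrite /y enormZ ?invr_ge0 ?enorm_ge0 // mulVf // gt_eqF.
have Ay : Anorm A y <= mu A.
  apply: ub_le_sup; first by case: has_sup_mu.
  by exists y => //; split=> //; rewrite ny.
have hy : has_inf (reps y) by rewrite yl; exact: has_inf_reps.
have [s /repsP[r [r0 yr ->]] rlt] := inf_adherent (divr_gt0 e0 nx) hy.
exists (enorm x *: r); split.
- by move=> j; rewrite mxE mulr_ge0 ?enorm_ge0.
- by rewrite -scalemxAr -yr /y scalerA divff ?scale1r // gt_eqF.
- under eq_bigr do rewrite mxE.
  rewrite -mulr_sumr -ler_pdivlMl // (le_trans (ltW rlt)) //.
  rewrite mulrDr mulrCA mulVf ?gt_eqF // mulr1 mulrC.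
  by rewrite (mulrC _^-1 e) lerD2r.
Qed.

End ANorm.

(** * The angle between [b] and the cone, and the deterministic core of the argument *)

Section Separation.
Context {R : realType}.

(** The cone contains the whole ray through [x], so the distance bound holds for [b - t *: x] at
    every [t >= 0]. The value [t = 0] gives the first claim, and the minimizing [t], which is
    [dotp b x / dotp x x], the second. *)
Lemma cone_dotp_le m n (A : 'M[R]_(m, n)) (b x : 'cV[R]_m) (Delta : R) :
    enorm b = 1 -> 0 < Delta -> Delta <= dist_cone A b -> cone A x ->
  0 <= 1 - Delta ^+ 2 /\ dotp b x <= Num.sqrt (1 - Delta ^+ 2) * enorm x.
Proof.
move=> b1 D0 Dd cx.
have bb : dotp b b = 1 by rewrite -enorm_sqr b1 expr1n.
have dist t : 0 <= t ->
    Delta ^+ 2 <= 1 - 2 * t * dotp b x + t ^+ 2 * dotp x x.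
  move=> t0; have : Delta <= enorm (b - t *: x).
    apply: le_trans Dd _; apply: ge_inf.
      by exists 0 => s [y _ <-]; exact: enorm_ge0.
    exists (t *: x) => //; have [l [l0 ->]] := (coneP _ _).1 cx.
    apply/coneP; exists (t *: l); split=> [j|]; first by rewrite mxE mulr_ge0.
    by rewrite -scalemxAr.
  rewrite -(ler_pXn2r (ltn0Sn 1)) ?nnegrE ?enorm_ge0 ?(ltW D0) //.
  move=> /le_trans; apply; rewrite enorm_sqr.
  rewrite !(dotpDl, dotpDr, dotpNl, dotpNr, dotpZl, dotpZr) bb (dotpC x b).
  lra.
have D1 : 0 <= 1 - Delta ^+ 2 by have := dist 0 (lexx 0); lra.
split=> //; have [bx|bx] := leP (dotp b x) 0.
  by rewrite (le_trans bx) // mulr_ge0 ?sqrtr_ge0 ?enorm_ge0.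
have xx : 0 < dotp x x.
  rewrite lt_neqAle dotp_ge0 andbT; apply: contraTN bx => /eqP/esym/dotp_eq0 ->.
  by rewrite dotp0r ltxx.
rewrite -(ler_pXn2r (ltn0Sn 1)) ?nnegrE; first last.
- by rewrite mulr_ge0 ?sqrtr_ge0 ?enorm_ge0.
- exact: ltW.
rewrite exprMn sqr_sqrtr // enorm_sqr.
have := dist (dotp b x / dotp x x) (divr_ge0 (ltW bx) (ltW xx)).
set u := dotp b x; set v := dotp x x.
have -> : 1 - 2 * (u / v) * u + (u / v) ^+ 2 * v = 1 - u ^+ 2 / v.
  by field; rewrite gt_eqF.
by move=> h; rewrite -ler_pdivrMr //; lra.
Qed.

(* For unit vectors u, v with inner product p, the Gram determinant of u - a v
   and mu u + v is (1 + mu a)^2 (1 - p^2). *)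
Lemma ratio_bound (a p mu : R) :
  (1 - p ^+ 2) * (1 + mu * a) ^+ 2
    <= (1 - 2 * a * p + a ^+ 2) * (mu ^+ 2 + 2 * mu * p + 1).
Proof.
rewrite -subr_ge0.
have -> : (1 - 2 * a * p + a ^+ 2) * (mu ^+ 2 + 2 * mu * p + 1)
    - (1 - p ^+ 2) * (1 + mu * a) ^+ 2 = (mu + p - a * mu * p - a) ^+ 2 by ring.
exact: sqr_ge0.
Qed.

(* With the columns of M = row_mx (- b) A, a vector T b = T x of the image cone
   is a nonnegative combination of the columns of M in the kernel of T. *)
Lemma not_cone_image k m n (A : 'M[R]_(m, n)) (b : 'cV[R]_m) (T : 'M[R]_(k, m))
    (Delta eps : R) (M := row_mx (- b) A) :
    ~ cone A b -> enorm b = 1 -> 0 < Delta -> Delta <= dist_cone A b ->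
    0 < eps ->
    eps < Delta ^+ 2 / (mu A ^+ 2 + 2 * mu A * Num.sqrt (1 - Delta ^+ 2) + 1) ->
    (forall i j, dotp (col i M) (col j M) - eps
       <= dotp (T *m col i M) (T *m col j M)) ->
  ~ cone (T *m A) (T *m b).
Proof.
move=> nb b1 D0 Dd e0 elt TM /coneP[l [l0 Tb]].
pose x := A *m l; pose p := Num.sqrt (1 - Delta ^+ 2).
have cx : cone A x by apply/coneP; exists l.
have [D1 bx] := cone_dotp_le b1 D0 Dd cx; rewrite -/p in bx elt.
have bb : dotp b b = 1 by rewrite -enorm_sqr b1 expr1n.
have m0 := mu_ge0 A; have nx0 := enorm_ge0 x.
have p0 : 0 <= p := sqrtr_ge0 _.
have key e : 0 < e ->
    dotp (b - x) (b - x) <= eps * (1 + mu A * enorm x + e) ^+ 2.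
  move=> e_gt0; have [r [r0 xr sr]] := cone_representation e_gt0 cx.
  pose w : 'cV[R]_(1 + n) := col_mx 1%:M r.
  have w0 i : 0 <= w i 0.
    rewrite mxE; case: (fintype.split i) => a; last exact: r0.
    by rewrite mxE; case: eqP.
  have Mw : M *m w = - (b - x) by rewrite mul_row_col mulmx1 xr opprB addrC.
  have TMw : T *m (M *m w) = 0.
    by rewrite Mw mulmxN mulmxBr {}Tb /x mulmxA subrr oppr0.
  have quad q (N : 'M[R]_(q, 1 + n)) : dotp (N *m w) (N *m w) =
      \sum_i \sum_j w i 0 * w j 0 * dotp (col i N) (col j N).
    rewrite /dotp trmx_mul mulmxA -(mulmxA w^T) mxE.
    under eq_bigr do rewrite mxE mulr_suml.
    rewrite exchange_big /=; apply: eq_bigr => i _; apply: eq_bigr => j _.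
    have -> : (N^T *m N) i j = ((col i N)^T *m col j N) 0 0.
      by rewrite !mxE; apply: eq_bigr => a _; rewrite !mxE.
    by rewrite mxE mulrAC.
  have sw : \sum_i w i 0 = 1 + \sum_j r j 0.
    rewrite big_split_ord /= big_ord1; congr (_ + _).
      by rewrite col_mxEu mxE eqxx.
    by apply: eq_bigr => j _; rewrite col_mxEd.
  (* Since [w] is nonnegative, entrywise lower bounds on the Gram matrix of [T *m M] add up to a
     lower bound on its quadratic form at [w]. *)
  have : dotp (M *m w) (M *m w) - eps * (\sum_i w i 0) ^+ 2
      <= dotp ((T *m M) *m w) ((T *m M) *m w).
    rewrite !quad expr2 mulr_suml mulr_sumr -sumrB ler_sum // => i _.
    rewrite !mulr_sumr -sumrB ler_sum // => j _.
    rewrite [eps * _]mulrC -mulrBr ler_wpM2l ?mulr_ge0 //.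
    by have := TM i j; rewrite !colE !mulmxA.
  rewrite -mulmxA TMw Mw sw dotpNl dotpNr opprK.
  rewrite dotp0r subr_le0 => /le_trans; apply.
  rewrite ler_wpM2l ?(ltW e0) // ler_pXn2r ?nnegrE -?addrA ?lerD2l //.
    by rewrite addr_ge0 // sumr_ge0.
  by rewrite !addr_ge0 ?(ltW e_gt0) // mulr_ge0.
(* After square roots the slack enters linearly, and being arbitrary it disappears. *)
have {}key : enorm (b - x) <= Num.sqrt eps * (1 + mu A * enorm x).
  rewrite -ler_pdivrMl ?sqrtr_gt0 //; apply/ler_addgt0Pr => e e_gt0.
  rewrite ler_pdivrMl ?sqrtr_gt0 // -(ler_pXn2r (ltn0Sn 1)) ?nnegrE ?enorm_ge0 //.
    by rewrite exprMn enorm_sqr sqr_sqrtr ?(ltW e0) // key.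
  by rewrite mulr_ge0 ?sqrtr_ge0 // !addr_ge0 ?(ltW e_gt0) // mulr_ge0.
move: key; rewrite -(ler_pXn2r (ltn0Sn 1)) ?nnegrE ?enorm_ge0 //; last first.
  by rewrite mulr_ge0 ?sqrtr_ge0 // addr_ge0 // mulr_ge0.
rewrite enorm_sqr exprMn sqr_sqrtr ?(ltW e0) //; apply/negP; rewrite -ltNge.
have -> : dotp (b - x) (b - x) = 1 - 2 * dotp b x + enorm x ^+ 2.
  rewrite !(dotpDl, dotpDr, dotpNl, dotpNr) bb (dotpC x b) enorm_sqr; ring.
have den0 : 0 < mu A ^+ 2 + 2 * mu A * p + 1.
  by rewrite ltr_wpDl // addr_ge0 ?sqr_ge0 // !mulr_ge0.
have num0 : 0 < (1 + mu A * enorm x) ^+ 2.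
  by rewrite exprn_gt0 // ltr_pwDl // mulr_ge0.
have p2 : 1 - p ^+ 2 = Delta ^+ 2 by rewrite sqr_sqrtr //; ring.
(* Here [p] is not the cosine of the angle between [b] and [x] but an upper bound for it; replacing
   the cosine by [p] only decreases the squared distance, and [1 - p ^+ 2] becomes [Delta ^+ 2]. *)
have := ratio_bound (enorm x) p (mu A); rewrite p2 => h.
apply: (@lt_le_trans _ _ (1 - 2 * enorm x * p + enorm x ^+ 2)).
  rewrite -ltr_pdivlMr // (lt_le_trans elt) //.
  by rewrite ler_pdivrMr // mulrAC ler_pdivlMr.
lra.
Qed.

End Separation.

(** * Measurability of the cone event *)

Section MeasurableCone.
Context {R : realType}.

(** Membership is rewritten with countable quantifiers only: coefficients are natural numbers over a
    common denominator, and the squared error is at most [1 / (p + 1)]. The bound [N] does not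
    depend on [p]; it confines the approximate solutions to a compact box, where the continuous
    squared error attains its minimum, and that minimum is 0. *)
Lemma cone_approx k n (B : 'M[R]_(k, n)) (v : 'cV[R]_k) :
  cone B v <-> exists N : nat, forall p : nat,
    exists qa : nat * {ffun 'I_n -> nat},
      (forall j, (qa.2 j)%:R / qa.1.+1%:R <= N%:R :> R) /\
      \sum_i (v i 0 - \sum_j (qa.2 j)%:R / qa.1.+1%:R * B i j) ^+ 2
        <= p.+1%:R^-1.
Proof.
split=> [/coneP[l [l0 ->]]|[N NP]].
- have s0 : 0 <= \sum_j l j 0 by apply: sumr_ge0.
  exists (Num.bound (\sum_j l j 0)) => p.
  pose S := \sum_i (\sum_j `|B i j|) ^+ 2.
  have S0 : 0 <= S by apply: sumr_ge0 => i _; exact: sqr_ge0.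
  (* Rounding the coefficients down to multiples of [1 / (q + 1)] produces a squared error of at
     most [S / (q + 1) ^ 2], and this [q] brings even [S / (q + 1)] below the tolerance. *)
  pose q := Num.bound (p.+1%:R * S).
  have q0 : (0 : R) < q.+1%:R by rewrite ltr0n.
  have Sq : S / q.+1%:R <= p.+1%:R^-1.
    rewrite ler_pdivrMr // mulrC ler_pdivlMr ?ltr0n // mulrC.
    have h : 0 <= p.+1%:R * S by rewrite mulr_ge0.
    by rewrite (le_trans (ltW (archi_boundP h))) // ler_nat.
  pose a : {ffun 'I_n -> nat} := [ffun j => Num.truncn (l j 0 * q.+1%:R)].
  have tr j : (a j)%:R / q.+1%:R <= l j 0 /\
      l j 0 - (a j)%:R / q.+1%:R <= q.+1%:R^-1.
    rewrite ffunE; have h : 0 <= l j 0 * q.+1%:R by rewrite mulr_ge0.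
    have /andP[h1 h2] := truncn_itv h.
    split; first by rewrite ler_pdivrMr.
    rewrite lerBlDr -(ler_pM2r q0) mulrDl mulVf ?gt_eqF // divfK ?gt_eqF //.
    by rewrite addrC natr1; exact: ltW.
  exists (q, a); split=> /= [j|].
    apply: (le_trans (tr j).1); apply: le_trans (ltW (archi_boundP s0)).
    by rewrite (bigD1 j) //= lerDl sumr_ge0.
  apply: le_trans Sq; rewrite /S mulr_suml ler_sum // => i _.
  rewrite mxE -sumrB.
  have -> : \sum_(j < n) (B i j * l j 0 - (a j)%:R / q.+1%:R * B i j)
      = \sum_j (l j 0 - (a j)%:R / q.+1%:R) * B i j.
    by apply: eq_bigr => j _; rewrite mulrBl [B i j * _]mulrC.
  rewrite -real_normK ?num_real //.
  apply: (@le_trans _ _ ((\sum_j `|B i j| / q.+1%:R) ^+ 2)).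
    rewrite ler_pXn2r ?nnegrE ?normr_ge0 //; last first.
      by apply: sumr_ge0 => j _; rewrite divr_ge0 // ltW.
    rewrite (le_trans (ler_norm_sum _ _ _)) // ler_sum // => j _.
    rewrite normrM mulrC ler_wpM2l // ger0_norm ?subr_ge0 ?(tr j).1 //.
    exact: (tr j).2.
  rewrite -mulr_suml exprMn ler_wpM2l ?sqr_ge0 // expr2 ler_piMr ?invr_ge0 ?(ltW q0) //.
  by rewrite invf_le1 // ler1n.
- pose f (l : 'rV[R]_n) := \sum_i (v i 0 - \sum_j l 0 j * B i j) ^+ 2.
  have fc : continuous f.
    move=> l; rewrite /f; apply: (cvg_big _ (nbhs_filter l)) => [|i _].
      exact: add_continuous.
    apply: (@continuous_comp _ _ _ (fun u : 'rV[R]_n =>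
      v i 0 - \sum_j u 0 j * B i j) (fun u => u ^+ 2)); last exact: exprn_continuous.
    apply: continuousB; first exact: cst_continuous.
    apply: (cvg_big _ (nbhs_filter l)) => [|j _].
      exact: add_continuous.
    apply: cvgMl; exact: coord_continuous.
  pose box := [set l : 'rV[R]_n | forall j, `[0, N%:R]%classic (l ord0 j)].
  have box0 : box !=set0 by exists 0 => j; rewrite mxE /= in_itv /= lexx ler0n.
  have cbox : compact box.
    apply: (@rV_compact _ _ (fun=> `[(0 : R), N%:R]%classic)) => j.
    exact: segment_compact.
  have [c {}cbox cmin] := EVT_min_rV box0 cbox (continuous_subspaceT fc).
  rewrite inE in cbox.
  have f0 : f c <= 0.
    apply/ler_addgt0Pr => e e0; rewrite add0r.
    pose p := Num.bound e^-1.
    have [[q a] /= [ab aP]] := NP p.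
    have := cmin (\row_j ((a j)%:R / q.+1%:R)).
    rewrite inE => /(_ _)/le_trans; apply.
      move=> j; rewrite mxE /= in_itv /= ab andbT.
      by rewrite divr_ge0.
    rewrite /f; under eq_bigr do under eq_bigr do rewrite mxE.
    apply: le_trans aP _; rewrite invf_ple ?posrE ?ltr0n //.
    rewrite (le_trans (ltW (archi_boundP _))) ?invr_ge0 ?(ltW e0) //.
    by rewrite ler_nat.
  apply/coneP; exists c^T; split=> [j|].
    by rewrite mxE; have := cbox j; rewrite /= in_itv /= => /andP[].
  apply/colP => i.
  have /eqP : f c = 0.
    by apply/eqP; rewrite eq_le f0 sumr_ge0 // => ? _; exact: sqr_ge0.
  rewrite psumr_eq0 => [/allP h|? _]; last exact: sqr_ge0.
  have := h i (mem_index_enum i); rewrite /= sqrf_eq0 subr_eq0 => /eqP ->.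
  by rewrite mxE; apply: eq_bigr => j _; rewrite mxE mulrC.
Qed.

Lemma measurable_cone d (Omega : measurableType d) k n
    (B : Omega -> 'M[R]_(k, n)) (v : Omega -> 'cV[R]_k) :
    (forall i j, measurable_fun [set: Omega] (fun w => B w i j)) ->
    (forall i, measurable_fun [set: Omega] (fun w => v w i 0)) ->
  measurable [set w | cone (B w) (v w)].
Proof.
move=> mB mv.
pose F (N p : nat) (qa : nat * {ffun 'I_n -> nat}) : set Omega :=
  [set w | (forall j, (qa.2 j)%:R / qa.1.+1%:R <= N%:R :> R) /\
      \sum_i (v w i 0 - \sum_j (qa.2 j)%:R / qa.1.+1%:R * B w i j) ^+ 2
        <= p.+1%:R^-1].
have -> : [set w | cone (B w) (v w)] = \bigcup_N \bigcap_p \bigcup_qa F N p qa.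
  apply/seteqP; split=> [w /cone_approx[N NP]|w [N _ NP]].
    by exists N => // p _; have [qa] := NP p; exists qa.
  apply/cone_approx; exists N => p; have [qa _] := NP p Logic.I.
  by exists qa.
apply: bigcupT_measurable => N; apply: bigcapT_measurable => p.
apply: countable_bigcupT_measurable; first exact: countableP.
move=> qa; rewrite /F.
have [H|H] := pselect (forall j, (qa.2 j)%:R / qa.1.+1%:R <= N%:R :> R).
  rewrite (_ : mkset _ = [set: Omega] `&` [set w |
    \sum_i (v w i 0 - \sum_j (qa.2 j)%:R / qa.1.+1%:R * B w i j) ^+ 2
        <= p.+1%:R^-1]); last first.
    by apply/seteqP; split=> [w []|w []].
  apply: measurable_fun_le => //.
  apply: measurable_sum => i; apply: measurable_funX; apply: measurable_funB => //.
  apply: measurable_sum => j; exact: measurable_funM.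
rewrite (_ : mkset _ = set0) //.
by apply/seteqP; split=> [w []|w].
Qed.

End MeasurableCone.

(** * Expectations and independence *)

Section RealExpectation.
Context {d : measure_display} {Omega : measurableType d} {R : realType}.
Variable P : probability Omega R.
Implicit Types f g : Omega -> R.

Definition integ f := P.-integrable [set: Omega] (EFin \o f).

(** [fine] sends an infinite integral to 0, which is why the rules of calculation for [Ex] carry
    [integ] hypotheses. *)
Definition Ex f : R := fine (\int[P]_w (f w)%:E)%E.

Lemma ExE f : integ f -> (\int[P]_w (f w)%:E)%E = (Ex f)%:E.
Proof. by move=> fi; rewrite /Ex fineK //; exact: integrable_fin_num. Qed.

Lemma integ_measurable f : integ f -> measurable_fun [set: Omega] f.
Proof. by move=> /measurable_int /measurable_EFinP. Qed.

Lemma integ_cst (c : R) : integ (fun=> c).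
Proof. exact: finite_measure_integrable_cst. Qed.

Lemma Ex_cst (c : R) : Ex (fun=> c) = c.
Proof.
have -> // : Ex (fun=> c) = fine (c%:E * P setT).
  by congr fine; exact: integral_cst.
by rewrite probability_setT mule1.
Qed.

Lemma integD f g : integ f -> integ g -> integ (fun w => f w + g w).
Proof. by move=> fi gi; exact: (integrableD measurableT fi gi). Qed.

Lemma ExD f g : integ f -> integ g -> Ex (fun w => f w + g w) = Ex f + Ex g.
Proof.
move=> fi gi; apply: EFin_inj; rewrite EFinD -!ExE //; last exact: integD.
exact: (integralD_EFin measurableT fi gi).
Qed.

Lemma integZ (c : R) f : integ f -> integ (fun w => c * f w).
Proof. by move=> fi; exact: (integrableZl measurableT c fi). Qed.

Lemma ExZ (c : R) f : integ f -> Ex (fun w => c * f w) = c * Ex f.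
Proof.
move=> fi; apply: EFin_inj; rewrite EFinM -!ExE //; last exact: integZ.
exact: (integralZl measurableT fi).
Qed.

Lemma Ex_le f g : integ f -> integ g -> (forall w, f w <= g w) -> Ex f <= Ex g.
Proof.
move=> fi gi fg; rewrite -lee_fin -!ExE //.
by apply: le_integral => // w _; rewrite lee_fin.
Qed.

Lemma Ex_ge0 f : (forall w, 0 <= f w) -> 0 <= Ex f.
Proof.
by move=> f0; apply: fine_ge0; apply: integral_ge0 => w _; rewrite lee_fin.
Qed.

Lemma integ_sum (I : Type) (r : seq I) (F : I -> Omega -> R) :
  (forall i, integ (F i)) -> integ (fun w => \sum_(i <- r) F i w).
Proof.
move=> Fi; elim: r => [|i r IH].
  by under eq_fun do rewrite big_nil; exact: integ_cst.
by under eq_fun do rewrite big_cons; exact: integD.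
Qed.

Lemma Ex_sum (I : Type) (r : seq I) (F : I -> Omega -> R) :
  (forall i, integ (F i)) ->
  Ex (fun w => \sum_(i <- r) F i w) = \sum_(i <- r) Ex (F i).
Proof.
move=> Fi; elim: r => [|i r IH].
  by under eq_fun do rewrite big_nil; rewrite Ex_cst big_nil.
under eq_fun do rewrite big_cons.
by rewrite big_cons ExD ?IH //; exact: integ_sum.
Qed.

Lemma ge0_integ f (c : R) : measurable_fun [set: Omega] f ->
    (forall w, 0 <= f w) -> (\int[P]_w (f w)%:E <= c%:E)%E ->
  integ f /\ Ex f <= c.
Proof.
move=> mf f0 fc; have fi : integ f.
  apply/integrableP; split; first exact/measurable_EFinP.
  under eq_integral => w _ do rewrite /= ger0_norm //.
  exact: le_lt_trans fc (ltry _).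
by split=> //; rewrite -lee_fin -ExE.
Qed.

Lemma integ_dom f g : measurable_fun [set: Omega] f -> integ g ->
  (forall w, `|f w| <= g w) -> integ f.
Proof.
move=> mf gi fg; apply: le_integrable gi => //; first exact/measurable_EFinP.
by move=> w _ /=; rewrite lee_fin (le_trans (fg w)) // ler_norm.
Qed.

Lemma measurable_ge_set f (a : R) : measurable_fun [set: Omega] f ->
  measurable [set w | a <= f w].
Proof.
move=> mf; rewrite -[X in measurable X]setTI.
exact: (measurable_fun_le measurableT (measurable_cst a) mf).
Qed.

Lemma markov_Ex f (a : R) : integ f -> (forall w, 0 <= f w) -> 0 < a ->
  (P [set w | (a <= f w)%R] <= (Ex f / a)%:E)%E.
Proof.
move=> fi f0 a0; have mf := integ_measurable fi.
set A := [set w | a <= f w].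
have mA : measurable A by exact: measurable_ge_set.
have PA := fin_num_measure P _ mA.
rewrite -(fineK PA) lee_fin ler_pdivlMr // mulrC -lee_fin EFinM fineK // -ExE //.
apply: (@le_trans _ _ (\int[P]_w (a%:E * (\1_A w)%:E))%E).
  rewrite ge0_integralZl_EFin ?(ltW a0) //; last first.
    exact/measurable_EFinP/measurable_indic.
  by rewrite integral_indic // setIT.
apply: ge0_le_integral => //.
- by move=> w _; rewrite -EFinM lee_fin mulr_ge0 // ltW.
- by apply: emeasurable_funM => //; exact/measurable_EFinP/measurable_indic.
- exact/measurable_EFinP.
- move=> w _; rewrite -EFinM lee_fin indicE.
  by case: (boolP (w \in A)) => [/set_mem|_]; rewrite ?mulr1 ?mulr0.
Qed.

End RealExpectation.

(** * Independence of functions of disjoint blocks of an independent family *)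

Section Independence.
Context {d : measure_display} {Omega : measurableType d} {R : realType}.
Variable P : probability Omega R.

Definition independent2 (X Y : Omega -> R) := forall A B : set R,
  measurable A -> measurable B ->
  P (X @^-1` A `&` Y @^-1` B) = (P (X @^-1` A) * P (Y @^-1` B))%E.

(** Independence says that the law of the pair and the product of the two laws agree on rectangles.
    Uniqueness of the product measure makes them equal, and Tonelli's theorem applies to the
    product. *)
Lemma independent2_tonelli (X Y : Omega -> R) (F : R * R -> \bar R) :
    measurable_fun [set: Omega] X -> measurable_fun [set: Omega] Y ->
    independent2 X Y -> measurable_fun [set: R * R] F ->
    (forall z, 0 <= F z)%E ->
  (\int[P]_w F (X w, Y w) = \int[P]_w (\int[P]_w' F (X w, Y w')))%E.
Proof.
move=> mX mY iXY mF F0.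
have mXY : measurable_fun [set: Omega] (fun w => (X w, Y w)).
  exact: measurable_fun_pair.
pose X' : {mfun Omega >-> R} := HB.pack X (isMeasurableFun.Build _ _ _ _ X mX).
pose Y' : {mfun Omega >-> R} := HB.pack Y (isMeasurableFun.Build _ _ _ _ Y mY).
pose Z' : {mfun Omega >-> (R * R)%type} :=
  HB.pack (fun w => (X w, Y w)) (isMeasurableFun.Build _ _ _ _ _ mXY).
transitivity (\int[distribution P Z']_z F z)%E.
  by rewrite ge0_integral_distribution.
transitivity (\int[distribution P X' \x distribution P Y']_z F z)%E.
  apply/esym/eq_measure_integral => A mA _; apply: product_measure_unique => //.
rewrite fubini_tonelli1 // /fubini_F ge0_integral_distribution //; first last.
- by move=> x; exact: integral_ge0.
- exact: measurable_fun_fubini_tonelli_F.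
apply: eq_integral => w _ /=; rewrite ge0_integral_distribution //.
exact: measurable_fun_pair2.
Qed.

Lemma independent2_ge0_integralM (X Y : Omega -> R) (f g : R -> R) :
    measurable_fun [set: Omega] X -> measurable_fun [set: Omega] Y ->
    independent2 X Y ->
    measurable_fun [set: R] f -> measurable_fun [set: R] g ->
    (forall x, 0 <= f x) -> (forall x, 0 <= g x) ->
  (\int[P]_w (f (X w) * g (Y w))%:E =
   \int[P]_w (f (X w))%:E * \int[P]_w (g (Y w))%:E)%E.
Proof.
move=> mX mY iXY mf mg f0 g0.
rewrite (@independent2_tonelli X Y (fun z => (f z.1 * g z.2)%:E)) //; last 2 first.
- by apply/measurable_EFinP; apply: measurable_funM; apply: measurableT_comp.
- by move=> z; rewrite lee_fin mulr_ge0.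
have mfX : measurable_fun [set: Omega] (fun w => (f (X w))%:E).
  by apply/measurable_EFinP; exact: measurableT_comp.
have mgY : measurable_fun [set: Omega] (fun w => (g (Y w))%:E).
  by apply/measurable_EFinP; exact: measurableT_comp.
rewrite -ge0_integralZr //; last 2 first.
- by move=> w _; rewrite lee_fin.
- by apply: integral_ge0 => w _; rewrite lee_fin.
apply: eq_integral => w _.
rewrite -ge0_integralZl_EFin //.
by move=> w' _; rewrite lee_fin.
Qed.

Section Family.
Variables (I : finType) (U : I -> {RV P >-> R}).
Hypothesis U_indep : mutually_independent U.

(** A pi-system of boxes in the full product [I -> R], constrained only in the coordinates of [J].
    Measurability for the sigma-algebra it generates encodes dependence on the coordinates of [J]
    alone. *)
Definition cylinders (J : {set I}) : set (set (I -> R)) :=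
  [set A | exists B : I -> set R, (forall i, measurable (B i)) /\
     A = [set x | forall i, i \in J -> B i (x i)]].

Lemma cylinders_setI_closed J : setI_closed (cylinders J).
Proof.
move=> _ _ [B1 [mB1 ->]] [B2 [mB2 ->]].
exists (fun i => B1 i `&` B2 i); split=> [i|]; first exact: measurableI.
apply/seteqP; split=> x /=; first by move=> [h1 h2] i iJ; split; [apply: h1|apply: h2].
by move=> h; split=> i iJ; case: (h i iJ).
Qed.

Lemma measurable_coord (J : {set I}) i : i \in J ->
  measurable_fun [set: g_sigma_algebraType (cylinders J)] (fun x => x i).
Proof.
move=> iJ _ A mA; rewrite setTI; apply: sub_sigma_algebra.
exists (fun j => if j == i then A else setT); split=> [j|]; first by case: eqP.
apply/seteqP; split=> x /=; first by move=> Ax j _; case: eqP => // ->.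
by move=> /(_ i iJ); rewrite eqxx.
Qed.

Let Uvec (w : Omega) (i : I) : R := U i w.

Let cylinder_measurable J (A : set (I -> R)) :
  cylinders J A -> measurable (Uvec @^-1` A).
Proof.
move=> [B [mB ->]].
have -> : Uvec @^-1` [set x | forall i, i \in J -> B i (x i)] =
    \bigcap_(i in [set` J]) (U i @^-1` B i) by [].
apply: fin_bigcap_measurable; first exact: finite_finset.
by move=> i _; exact: measurable_funPTI.
Qed.

(** Pi-lambda theorem: the sets whose preimage is independent of the fixed event [E] form a
    lambda-system containing the boxes. *)
Let extend_independence J (E : set Omega) : measurable E ->
    (forall A, cylinders J A ->
      P (Uvec @^-1` A `&` E) = (P (Uvec @^-1` A) * P E)%E) ->
  forall A, <<s cylinders J >> A -> measurable (Uvec @^-1` A) /\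
      P (Uvec @^-1` A `&` E) = (P (Uvec @^-1` A) * P E)%E.
Proof.
move=> mE HE; apply: (@lambda_system_subset _ _ (@cylinders_setI_closed J) setT
  [set A | measurable (Uvec @^-1` A) /\
      P (Uvec @^-1` A `&` E) = (P (Uvec @^-1` A) * P E)%E]) => //; last first.
  by move=> A cA; split; [exact: cylinder_measurable cA | exact: HE].
apply/dynkin_lambda_system; split.
- by split; rewrite preimage_setT // setTI probability_setT mul1e.
- move=> A [mA PA]; split; first by rewrite preimage_setC; exact: measurableC.
  have -> : Uvec @^-1` (~` A) = ~` (Uvec @^-1` A) by [].
  move: mA PA; set a := Uvec @^-1` A => ma Pa.
  transitivity (P E - P (a `&` E))%E.
    rewrite setIC -setDE measureD //; last by rewrite ltey_eq fin_num_measure.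
    by rewrite (setIC E).
  rewrite Pa probability_setC //.
  by rewrite muleBl ?fin_num_measure // ?mul1e //.
- move=> F tF FH.
  have mF n : measurable (Uvec @^-1` F n) by case: (FH n).
  have mU : measurable (Uvec @^-1` \bigcup_k F k).
    by rewrite preimage_bigcup; exact: bigcupT_measurable.
  split=> //; rewrite preimage_bigcup setI_bigcupl.
  have tF' : trivIset setT (fun n => Uvec @^-1` F n).
    by move=> i j _ _ [w [Fi Fj]]; apply: (tF i j) => //; exists (Uvec w).
  rewrite !measure_bigcup //; last 2 first.
  + by move=> n _; exact: measurableI.
  + by apply: trivIset_setIr.
  rewrite muleC -[X in (X * _)%E]fineK ?fin_num_measure // -nneseriesZl //.
  apply: eq_eseriesr => n _; rewrite fineK ?fin_num_measure // muleC.
  exact: (FH n).2.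
Qed.

(** The extension is applied once in each argument. What remains is the case of two boxes; their
    coordinates being disjoint, they merge into one box over the union of the index sets, to which
    mutual independence applies. *)
Lemma independent_sigma_cylinders (J1 J2 : {set I}) (A B : set (I -> R)) :
    (forall i, i \in J1 -> i \notin J2) -> <<s cylinders J1 >> A -> <<s cylinders J2 >> B ->
  P (Uvec @^-1` A `&` Uvec @^-1` B) = (P (Uvec @^-1` A) * P (Uvec @^-1` B))%E.
Proof.
move=> J12 sA sB.
have mS J C : <<s cylinders J >> C -> measurable (Uvec @^-1` C).
  by move=> sC; case: (@extend_independence J setT measurableT _ C sC) => // D _;
     rewrite setIT probability_setT mule1.
apply: (extend_independence (mS _ _ sB) _ sA).2 => {sA}A cA.
rewrite setIC muleC.
apply: (extend_independence (cylinder_measurable cA) _ sB).2 => {sB}B cB.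
move: cA cB => [B1 [mB1 ->]] [B2 [mB2 ->]].
have bigcapE (J : {set I}) (C : I -> set R) :
  Uvec @^-1` [set x | forall i, i \in J -> C i (x i)] =
    \bigcap_(i in [set` J]) (U i @^-1` C i) by [].
pose C i := if i \in J1 then B1 i else B2 i.
have mC i : measurable (C i) by rewrite /C; case: ifP.
have j12 i : i \in J2 -> (i \in J1) = false.
  by move=> iJ2; apply/negbTE; apply: contraL iJ2 => /J12.
have -> : Uvec @^-1` [set x | forall i, i \in J2 -> B2 i (x i)] `&`
    Uvec @^-1` [set x | forall i, i \in J1 -> B1 i (x i)] =
    \bigcap_(i in [set` J1 :|: J2]) (U i @^-1` C i).
  apply/seteqP; split=> w /=.
    move=> [h2 h1] i /=; rewrite /C inE; case: ifP => [iJ1 _|iJ1 /= iJ2].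
      exact: h1.
    exact: h2.
  move=> h; split=> i iJ; have := h i; rewrite /C /= inE iJ ?orbT.
    by rewrite j12 //; exact.
  by rewrite /=; exact.
rewrite U_indep // !bigcapE !U_indep //.
rewrite (big_setID J1) /= muleC.
rewrite (_ : (J1 :|: J2) :&: J1 = J1)%SET; last first.
  by apply/setP => i; rewrite !inE; case: (i \in J1); rewrite ?andbF.
congr (_ * _)%E; last by apply: eq_bigr => i iJ; rewrite /C iJ.
rewrite (_ : (J1 :|: J2) :\: J1 = J2)%SET; last first.
  apply/setP => i; rewrite !inE; case: (boolP (i \in J2)) => [/j12 ->|] //=.
  by case: (i \in J1).
by apply: eq_bigr => i iJ; rewrite /C j12.
Qed.

Lemma independent2_disjoint (J1 J2 : {set I}) (phi psi : (I -> R) -> R) :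
    (forall i, i \in J1 -> i \notin J2) ->
    measurable_fun [set: g_sigma_algebraType (cylinders J1)] phi ->
    measurable_fun [set: g_sigma_algebraType (cylinders J2)] psi ->
  independent2 (fun w => phi (U ^~ w)) (fun w => psi (U ^~ w)).
Proof.
move=> J12 mphi mpsi A B mA mB.
have := @independent_sigma_cylinders J1 J2 (phi @^-1` A) (psi @^-1` B) J12.
apply.
- by have := mphi measurableT _ mA; rewrite setTI.
- by have := mpsi measurableT _ mB; rewrite setTI.
Qed.

End Family.

End Independence.

(** * Sub-Gaussian variables *)

Section ExponentialInequalities.
Context {R : realType}.
Implicit Types x t : R.

Lemma expR_le_inv x : x < 1 -> expR x <= (1 - x)^-1.
Proof.
move=> x1; rewrite -[x]opprK expRN lef_pV2 ?posrE ?expR_gt0 ?opprK ?subr_gt0 //.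
by rewrite (le_trans _ (expR_ge1Dx _)) // opprK.
Qed.

(** For [x >= 0], use [expR x - 1 <= x * expR x] twice. For [x < 0], start from
    [expR x <= (1 - x)^-1] and clear the denominator. *)
Lemma expR_le_taylor1 x : expR x <= 1 + x + x ^+ 2 * expR `|x|.
Proof.
have [x0|x0] := leP 0 x.
- rewrite ger0_norm //.
  have h : expR x - 1 <= x * expR x.
    have : expR x * (1 + - x) <= expR x * expR (- x).
      by rewrite ler_wpM2l ?expR_ge0 ?expR_ge1Dx.
    by rewrite expRxMexpNx_1; lra.
  have : x * (expR x - 1) <= x * (x * expR x) by rewrite ler_wpM2l.
  by rewrite expr2 -mulrA; lra.
- have h : expR x <= (1 - x)^-1 by rewrite expR_le_inv //; lra.
  have y0 : 0 < 1 - x by lra.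
  have e1 : 1 <= expR `|x| by rewrite -[leLHS]expR0 ler_expR.
  rewrite (le_trans h) // -(ler_pM2l y0) mulfV ?gt_eqF //.
  have : x ^+ 2 * 1 <= x ^+ 2 * expR `|x| by rewrite ler_wpM2l ?sqr_ge0.
  have x3 : 0 <= - x * (x ^+ 2 * expR `|x|).
    by rewrite mulr_ge0 ?oppr_ge0 ?(ltW x0) // mulr_ge0 ?sqr_ge0 ?expR_ge0.
  have -> : (1 - x) * (1 + x + x ^+ 2 * expR `|x|) = 1 - x ^+ 2 +
    x ^+ 2 * expR `|x| + - x * (x ^+ 2 * expR `|x|) by ring.
  by lra.
Qed.

Lemma sqr_le_expR x : 0 <= x -> x ^+ 2 <= 4 * expR x.
Proof.
move=> x0; have := expR_ge1Dx (x / 2).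
have e : expR x = expR (x / 2) ^+ 2 by rewrite expr2 -expRD; congr expR; lra.
move=> h; have : (x / 2) ^+ 2 <= expR x.
  by rewrite e ler_pXn2r ?nnegrE ?expR_ge0 ?divr_ge0 //; lra.
by rewrite exprMn exprVn; lra.
Qed.

(** The factor 2 in the exponent leaves room for elementary bounds. For [0 <= t <= 1/2] the left
    side is at most [1 / (1 - t ^ 2)]; for larger [t] it is at most [expR t], and
    [t <= 2 * t ^ 2]. *)
Lemma cosh_le_expR t : (expR t + expR (- t)) / 2 <= expR (2 * t ^+ 2).
Proof.
wlog t0 : t / 0 <= t.
  move=> H; have [|/ltW] := leP 0 t; first exact: H.
  by rewrite -oppr_ge0 => /H; rewrite opprK sqrrN addrC.
have [t1|t1] := leP t (1 / 2).
- have h1 : expR t <= (1 - t)^-1 by rewrite expR_le_inv //; lra.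
  have h2 : expR (- t) <= (1 + t)^-1 by rewrite -{2}[t]opprK expR_le_inv //; lra.
  apply: le_trans (expR_ge1Dx _).
  have a0 : 0 < 1 - t by lra.
  have b0 : 0 < 1 + t by lra.
  have c0 : 0 < (1 - t) * (1 + t) by rewrite mulr_gt0.
  have -> : 1 + 2 * t ^+ 2 = ((1 + 2 * t ^+ 2) * ((1 - t) * (1 + t)))
     / ((1 - t) * (1 + t)) by rewrite mulfK // gt_eqF.
  apply: (@le_trans _ _ (((1 - t)^-1 + (1 + t)^-1) / 2)); first by lra.
  have -> : ((1 - t)^-1 + (1 + t)^-1) / 2 = 1 / ((1 - t) * (1 + t)).
    by field; rewrite !gt_eqF.
  rewrite ler_pM2r ?invr_gt0 //.
  have : 0 <= t ^+ 2 * (1 - 2 * t ^+ 2).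
    by rewrite mulr_ge0 ?sqr_ge0 // subr_ge0; nra.
  have -> : (1 + 2 * t ^+ 2) * ((1 - t) * (1 + t)) =
    1 + t ^+ 2 * (1 - 2 * t ^+ 2) by ring.
  by lra.
- have h1 : expR (- t) <= expR t by rewrite ler_expR; lra.
  apply: (@le_trans _ _ (expR t)); first by lra.
  by rewrite ler_expR expr2 mulrA -{1}[t]mul1r ler_wpM2r //; lra.
Qed.

End ExponentialInequalities.

Section GaussianIntegrals.
Context {R : realType}.
Notation leb := (@lebesgue_measure R).

(** The Radon-Nikodym derivative of the normal law equals [normal_pdf] almost everywhere, because
    both have the same integral over every measurable set. *)
Lemma ge0_integral_normal_prob (m s : R) (f : R -> R) :
    measurable_fun [set: R] f -> (forall x, 0 <= f x) ->
  (\int[normal_prob m s]_x (f x)%:E =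
   \int[leb]_x (f x * normal_pdf m s x)%:E)%E.
Proof.
move=> mf f0; have dom := normal_prob_dominates m s.
rewrite -(Radon_Nikodym_SigmaFinite.change_of_variables dom) //; last exact/measurable_EFinP.
under [RHS]eq_integral do rewrite EFinM.
apply: ae_eq_integral => //.
- apply: emeasurable_funM; first exact/measurable_EFinP.
  by apply: measurable_int; exact: Radon_Nikodym_SigmaFinite.f_integrable.
- apply: emeasurable_funM; first exact/measurable_EFinP.
  by apply/measurable_EFinP; exact: measurable_normal_pdf.
- apply: ae_eqe_mul2l; apply: integral_ae_eq => //.
  + exact: Radon_Nikodym_SigmaFinite.f_integrable.
  + by apply/measurable_EFinP; exact: measurable_normal_pdf.
  + by move=> E _ mE; rewrite -Radon_Nikodym_SigmaFinite.f_integral.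
Qed.

Lemma normal_pdf01 (x : R) :
  normal_pdf 0 1 x = normal_peak 1 * expR (- x ^+ 2 / 2).
Proof.
rewrite normal_pdfE ?oner_neq0 // /normal_fun subr0 expr1n.
by rewrite -[1 *+ 2]/(2%:R).
Qed.

(** Completing the square turns the integrand into a constant times the density of the normal law
    with mean [t]. *)
Lemma normal_exp_linear (t : R) :
  (\int[normal_prob 0 1]_x (expR (t * x))%:E = (expR (t ^+ 2 / 2))%:E)%E.
Proof.
rewrite ge0_integral_normal_prob; last 2 first.
- by apply: measurableT_comp => //; exact: measurable_funM.
- by move=> x; exact: expR_ge0.
transitivity (\int[leb]_x ((expR (t ^+ 2 / 2))%:E * (normal_pdf t 1 x)%:E))%E.
  apply: eq_integral => x _; rewrite -EFinM normal_pdf01; congr EFin.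
  rewrite normal_pdfE ?oner_neq0 // /normal_fun expr1n mulrCA [RHS]mulrCA.
  congr (_ * _); rewrite -!expRD; congr expR.
  by rewrite -[1 *+ 2]/(2%:R : R); field.
rewrite ge0_integralZl_EFin ?expR_ge0 //; last 2 first.
- by move=> x _; rewrite lee_fin normal_pdf_ge0.
- by apply/measurable_EFinP; exact: measurable_normal_pdf.
by rewrite integral_normal_pdf mule1.
Qed.

(** With the coefficient written as [(1 - q ^+ 2) / 2], the integrand times the standard density is
    [q^-1] times the centered normal density of standard deviation [q^-1]; the parametrization keeps
    square roots out of the value. *)
Lemma normal_exp_square (q : R) : 0 < q ->
  (\int[normal_prob 0 1]_x (expR ((1 - q ^+ 2) / 2 * x ^+ 2))%:E = (q^-1)%:E)%E.
Proof.
move=> q0; rewrite ge0_integral_normal_prob; last 2 first.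
- apply: measurableT_comp => //; exact: measurable_funM.
- by move=> x; exact: expR_ge0.
have qi0 : q^-1 != 0 by rewrite invr_eq0 gt_eqF.
have peak : normal_peak 1 = q^-1 * normal_peak q^-1.
  rewrite /normal_peak expr1n mul1r -mulrnAr sqrtrM ?sqr_ge0 //.
  by rewrite sqrtr_sqr ger0_norm ?invr_ge0 ?(ltW q0) // invfM mulrA divff ?mul1r.
transitivity (\int[leb]_x ((q^-1)%:E * (normal_pdf 0 q^-1 x)%:E))%E.
  apply: eq_integral => x _; rewrite -EFinM normal_pdf01 peak; congr EFin.
  rewrite normal_pdfE // /normal_fun subr0 mulrCA -!mulrA; congr (_ * (_ * _)).
  rewrite -!expRD; congr expR.
  by rewrite -mulr_natr; field; rewrite gt_eqF.
rewrite ge0_integralZl_EFin ?invr_ge0 ?(ltW q0) //; last 2 first.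
- by move=> x _; rewrite lee_fin normal_pdf_ge0.
- by apply/measurable_EFinP; exact: measurable_normal_pdf.
by rewrite integral_normal_pdf mule1.
Qed.

End GaussianIntegrals.

Section SubGaussian.
Context {d : measure_display} {Omega : measurableType d} {R : realType}.
Variable P : probability Omega R.

(** The integral is extended-real, so the inequality includes its finiteness. Centering is not part
    of the definition; it is derived in [subgaussian_mean0]. *)
Definition subgaussian (B : R) (X : Omega -> R) := forall t : R,
  (\int[P]_w (expR (t * X w))%:E <= (expR (B * t ^+ 2))%:E)%E.

Variables (B : R) (X : Omega -> R).
Hypotheses (mX : measurable_fun [set: Omega] X) (B0 : 0 <= B).
Hypothesis sX : subgaussian B X.

Lemma measurable_expRZ t : measurable_fun [set: Omega] (fun w => expR (t * X w)).
Proof. by apply: measurableT_comp => //; exact: measurable_funM. Qed.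

Lemma subgaussian_integ_exp t : integ P (fun w => expR (t * X w)) /\
  Ex P (fun w => expR (t * X w)) <= expR (B * t ^+ 2).
Proof.
apply: ge0_integ; [exact: measurable_expRZ|by move=> w; exact: expR_ge0|].
exact: sX.
Qed.

Let expR_norm (x : R) : expR `|x| <= expR (1 * x) + expR (-1 * x).
Proof.
rewrite mul1r mulN1r; case: (ger0P x) => _.
  by rewrite lerDl expR_ge0.
by rewrite lerDr expR_ge0.
Qed.

Let integ_dom_exp : integ P (fun w => expR (1 * X w) + expR (-1 * X w)).
Proof. by apply: integD; exact: (subgaussian_integ_exp _).1. Qed.

Lemma subgaussian_integ : integ P X.
Proof.
apply: integ_dom integ_dom_exp _ => // w.
rewrite (le_trans _ (expR_norm _)) // (le_trans _ (expR_ge1Dx _)) //.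
by rewrite lerDr.
Qed.

Lemma subgaussian_integ_sqr : integ P (fun w => X w ^+ 2).
Proof.
apply: integ_dom (integZ 4 integ_dom_exp) _ => [|w].
  exact: measurable_funX.
rewrite ger0_norm ?sqr_ge0 // -(real_normK (num_real (X w))).
by rewrite (le_trans (sqr_le_expR (normr_ge0 _))) // ler_pM2l.
Qed.

Let mean_le t : t * Ex P X <= expR (B * t ^+ 2) - 1.
Proof.
rewrite lerBrDl -ExZ; last exact: subgaussian_integ.
rewrite -[X in X + _](Ex_cst P 1) -ExD; first last.
- exact/integZ/subgaussian_integ.
- exact: integ_cst.
apply: le_trans (subgaussian_integ_exp t).2.
apply: Ex_le => [||w]; last exact: expR_ge1Dx.
- apply: integD; first exact: integ_cst.
  exact/integZ/subgaussian_integ.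
- exact: (subgaussian_integ_exp t).1.
Qed.

(* Letting t tend to 0 in t E X <= exp(B t^2) - 1, for both signs of t. *)
Lemma subgaussian_mean0 : Ex P X = 0.
Proof.
pose c := B + 1; have c0 : 0 < c by rewrite ltr_wpDl.
have small (t : R) : 0 <= t -> t <= (2 * c)^-1 -> `|Ex P X| * t <= 2 * c * t ^+ 2.
  move=> t0 tc.
  have ct : c * t ^+ 2 <= 1 / 2.
    have h1 : c * t <= 1 / 2.
      have : c * t <= c * (2 * c)^-1 by rewrite ler_pM2l.
      by rewrite invfM mulrCA divff ?gt_eqF // mulr1 div1r.
    have h2 : t <= 1 \/ 1 < t by case: (leP t 1); [left|right].
    have c1 : 1 <= c by rewrite lerDr.
    have t1 : t <= 1 by nra.
    by rewrite expr2 mulrA; nra.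
  have ct0 : 0 <= c * t ^+ 2 by rewrite mulr_ge0 ?sqr_ge0 // ltW.
  have e2 : expR (B * t ^+ 2) - 1 <= 2 * c * t ^+ 2.
    apply: (@le_trans _ _ (expR (c * t ^+ 2) - 1)).
      by rewrite lerD2r ler_expR ler_wpM2r ?sqr_ge0 // lerDl.
    have h : expR (c * t ^+ 2) <= (1 - c * t ^+ 2)^-1.
      by apply: expR_le_inv; lra.
    rewrite lerBlDr (le_trans h) // -[leLHS]mul1r ler_pdivrMr; last by lra.
    set u := c * t ^+ 2; rewrite -mulrA -/u.
    by rewrite -/u in ct ct0; nra.
  have [m0|m0] := leP 0 (Ex P X).
    by rewrite ger0_norm // mulrC (le_trans (mean_le t)).
  rewrite ltr0_norm // mulNr mulrC -mulNr.
  by apply: le_trans (mean_le (- t)) _; rewrite sqrrN.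
apply/eqP; rewrite -normr_le0 leNgt; apply/negP => m0.
set m := `|Ex P X| in small m0.
(* If the test point [m / (4 * c)] is admissible, [small] gives [m <= m / 2] there. Otherwise
   [m > 2], while [small] at the endpoint [(2 * c)^-1] gives [m <= 1]. *)
have [h|h] := leP (m / (4 * c)) (2 * c)^-1.
- have t0 : 0 < m / (4 * c) by rewrite divr_gt0 // mulr_gt0.
  have := small _ (ltW t0) h.
  have : 2 * c * (m / (4 * c)) = m / 2 by field; rewrite gt_eqF.
  set t := m / (4 * c) in t0 *.
  by move=> E; rewrite expr2 [2 * c * (t * t)]mulrA E ler_pM2r //; lra.
- have t0 : 0 < (2 * c)^-1 by rewrite invr_gt0 mulr_gt0.
  have := small _ (ltW t0) (lexx _); rewrite expr2 mulrA ler_pM2r //.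
  rewrite mulfV ?gt_eqF ?mulr_gt0 // => m1.
  move: h; rewrite ltNge => /negP; apply.
  rewrite ler_pdivrMr ?mulr_gt0 // (le_trans m1) //.
  have -> : (2 * c)^-1 * (4 * c) = 2 by field; rewrite gt_eqF.
  lra.
Qed.

End SubGaussian.

Section SquareMGF.
Context {d : measure_display} {Omega : measurableType d} {R : realType}.
Variable P : probability Omega R.
Variable X : Omega -> R.
(** The parameter 6 is the largest ratio of sub-Gaussian parameter to variance among the three entry
    laws: 2 over 1/3, for sparse signs. *)
Hypotheses (mX : measurable_fun [set: Omega] X) (sX : subgaussian P 6 X).

(* exp(x^2/32) is the moment generating function of a standard normal variable
   at x/4, so integrating over X first reduces the claim to a Gaussian
   integral. *)
Lemma subgaussian_exp_sqr :
  integ P (fun w => expR (X w ^+ 2 / 32)) /\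
  Ex P (fun w => expR (X w ^+ 2 / 32)) <= 2.
Proof.
have mX2 : measurable_fun [set: Omega] (fun w => expR (X w ^+ 2 / 32)).
  apply: measurableT_comp => //; apply: measurable_funM => //.
  exact: measurable_funX.
apply: ge0_integ => //.
pose f (z : Omega * R) := (expR (X z.1 / 4 * z.2))%:E.
have mf : measurable_fun [set: Omega * R] f.
  apply/measurable_EFinP; apply: measurableT_comp => //.
  apply: measurable_funM => //; apply: measurable_funM => //.
  exact: measurableT_comp.
have -> : (\int[P]_w (expR (X w ^+ 2 / 32))%:E =
    \int[P]_w \int[normal_prob 0 1]_x f (w, x))%E.
  apply: eq_integral => w _; rewrite /f /= normal_exp_linear.
  by congr (expR _)%:E; field.
rewrite fubini_tonelli //; last by move=> z; rewrite lee_fin expR_ge0.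
(* Integrating over [X] gives at most [expR (6 * (x / 4) ^ 2) = expR (3 / 8 * x ^ 2)], which is the
   integrand of [normal_exp_square] at [q = 1 / 2]; hence the bound 2. *)
have q0 : (0 : R) < 1 / 2 by [].
have := normal_exp_square q0; rewrite div1r invrK => <-.
apply: ge0_le_integral => //.
- by move=> x _; apply: integral_ge0 => w _; rewrite lee_fin expR_ge0.
- by apply: (@measurable_fun_fubini_tonelli_G _ _ _ _ _ P f mf) => z; rewrite lee_fin expR_ge0.
- apply/measurable_EFinP; apply: measurableT_comp => //.
  by apply: measurable_funM => //; exact: measurable_funX.
- move=> x _; apply: le_trans (le_trans (sX (x / 4)) _).
    by rewrite le_eqVlt; apply/orP; left; apply/eqP; apply: eq_integral => w _;
      rewrite /f /=; congr (expR _)%:E; ring.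
  by rewrite lee_fin ler_expR le_eqVlt; apply/orP; left; apply/eqP; field.
Qed.

(** In the Taylor remainder [h^2 x^4 exp(|h| x^2)], the condition on [h] bounds the exponential by
    [exp(x^2/64)], and [x^4] is at most [4 * 64^2 * exp(x^2/64)]. The product is
    [2^14 h^2 exp(x^2/32)], of expectation at most [2^15 h^2]. *)
Lemma subgaussian_mgf_sqr (h : R) : Ex P (fun w => X w ^+ 2) = 1 ->
    `|h| <= 1 / 64 ->
  (\int[P]_w (expR (h * X w ^+ 2))%:E <= (expR (h + 2 ^+ 15 * h ^+ 2))%:E)%E.
Proof.
move=> X1 h64; have [ei e2] := subgaussian_exp_sqr.
have X2i := subgaussian_integ_sqr mX sX.
have mE : measurable_fun [set: Omega] (fun w => expR (h * X w ^+ 2)).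
  apply: measurableT_comp => //; apply: measurable_funM => //.
  exact: measurable_funX.
pose g w := (1 + h * X w ^+ 2) + 2 ^+ 14 * h ^+ 2 * expR (X w ^+ 2 / 32).
have li : integ P (fun w => 1 + h * X w ^+ 2).
  by apply: integD; [exact: integ_cst | exact: integZ].
have gi : integ P g by apply: integD => //; exact: integZ.
have fg w : expR (h * X w ^+ 2) <= g w.
  set x := X w ^+ 2; have x0 : 0 <= x := sqr_ge0 _.
  rewrite (le_trans (expR_le_taylor1 _)) // /g -/x lerD2l.
  have -> : 2 ^+ 14 * h ^+ 2 * expR (x / 32)
     = h ^+ 2 * (4 * 64 ^+ 2 * expR (x / 64)) * expR (x / 64).
    have -> : expR (x / 32) = expR (x / 64) * expR (x / 64).
      by rewrite -expRD; congr expR; field.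
    by ring.
  rewrite exprMn; apply: ler_pM.
  - by apply: mulr_ge0; exact: sqr_ge0.
  - exact: expR_ge0.
  - rewrite ler_wpM2l ?sqr_ge0 //.
    have := @sqr_le_expR R (x / 64) (divr_ge0 x0 (ler0n _ _)).
    by rewrite expr_div_n; lra.
  - rewrite ler_expR normrM (ger0_norm x0) mulrC ler_wpM2l //.
    by rewrite (le_trans h64) // div1r.
have Ei : integ P (fun w => expR (h * X w ^+ 2)).
  by apply: integ_dom gi _ => // w; rewrite ger0_norm ?expR_ge0.
rewrite ExE // lee_fin (le_trans (Ex_le Ei gi fg)) // ExD //; last exact: integZ.
rewrite ExD; [|exact: integ_cst|exact: integZ].
rewrite Ex_cst !ExZ // X1; apply: le_trans (expR_ge1Dx _).
have : 2 ^+ 14 * h ^+ 2 * Ex P (fun w => expR (X w ^+ 2 / 32)) <= 2 ^+ 14 * h ^+ 2 * 2.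
  by rewrite ler_wpM2l // mulr_ge0 ?sqr_ge0.
by lra.
Qed.

End SquareMGF.

(** * Projectors with independent entries *)

Section LinearCombinations.
Context {d : measure_display} {Omega : measurableType d} {R : realType}.
Variable P : probability Omega R.

Lemma subgaussian_le (B B' : R) (X : Omega -> R) :
  B <= B' -> subgaussian P B X -> subgaussian P B' X.
Proof.
move=> BB' sX t; apply: le_trans (sX t) _.
by rewrite lee_fin ler_expR ler_wpM2r ?sqr_ge0.
Qed.

(** Measurability is asked only of the members of [r], because a coordinate is known to be
    measurable for [cylinders J] only if its index is in [J]. *)
Lemma measurable_sum_seq d' (T : measurableType d') (I : eqType) (r : seq I)
    (h : I -> T -> R) :
  (forall i, i \in r -> measurable_fun [set: T] (h i)) ->
  measurable_fun [set: T] (fun x => \sum_(i <- r) h i x).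
Proof.
elim: r => [_|i r IH mh].
  by under eq_fun do rewrite big_nil; exact: measurable_cst.
under eq_fun do rewrite big_cons.
apply: measurable_funD; first by apply: mh; rewrite mem_head.
by apply: IH => j jr; apply: mh; rewrite in_cons jr orbT.
Qed.

Variables (I : finType) (U : I -> {RV P >-> R}).
Hypothesis U_indep : mutually_independent U.
Variables (B s : R).
Hypotheses (B0 : 0 <= B) (sU : forall i, subgaussian P B (U i)).
Hypothesis varU : forall i, Ex P (fun w => U i w ^+ 2) = s.

Definition lincomb (a : I -> R) (r : seq I) (w : Omega) : R :=
  \sum_(i <- r) a i * U i w.

Lemma measurable_lincomb a r : measurable_fun [set: Omega] (lincomb a r).
Proof.
by apply: measurable_sum => i; exact: measurable_funM.
Qed.

Lemma independent_lincomb_cons a i r : i \notin r ->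
  independent2 P (U i) (lincomb a r).
Proof.
move=> ir; have := @independent2_disjoint _ _ _ P I U U_indep [set i]%SET
  [set j in r]%SET (fun x => x i) (fun x => \sum_(j <- r) a j * x j).
apply.
- by move=> j; rewrite !inE => /eqP ->.
- by apply: measurable_coord; rewrite inE.
- apply: measurable_sum_seq => j jr; apply: measurable_funM => //.
  by apply: measurable_coord; rewrite inE.
Qed.

Lemma lincomb_subgaussian a r : uniq r ->
  subgaussian P (B * \sum_(i <- r) a i ^+ 2) (lincomb a r).
Proof.
elim: r => [_ t|i r IH /= /andP[ir ur] t].
  rewrite big_nil mulr0 mul0r expR0.
  under eq_integral do rewrite /lincomb big_nil mulr0 expR0.
  have := integral_cst P measurableT 1%:E; rewrite mul1e => ->.
  by rewrite probability_le1.
have -> : (\int[P]_w (expR (t * lincomb a (i :: r) w))%:E =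
    \int[P]_w (expR (t * a i * U i w) * expR (t * lincomb a r w))%:E)%E.
  by apply: eq_integral => w _; rewrite /lincomb big_cons -expRD mulrDr mulrA.
rewrite (independent2_ge0_integralM (f := fun x => expR (t * a i * x))
  (g := fun x => expR (t * x))) //.
- have -> : B * (\sum_(j <- i :: r) a j ^+ 2) * t ^+ 2 =
     B * (t * a i) ^+ 2 + (B * \sum_(j <- r) a j ^+ 2) * t ^+ 2.
    by rewrite big_cons; ring.
  rewrite expRD EFinM; apply: lee_pmul.
  + by apply: integral_ge0 => w _; rewrite lee_fin expR_ge0.
  + by apply: integral_ge0 => w _; rewrite lee_fin expR_ge0.
  + exact: sU.
  + exact: IH.
- exact: measurable_lincomb.
- exact: independent_lincomb_cons.
- by apply: measurableT_comp => //; exact: measurable_funM.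
- by apply: measurableT_comp => //; exact: measurable_funM.
Qed.

(** A square is nonnegative, so Tonelli applies to the pair of partial sum and new entry. With the
    partial sum frozen, the cross term vanishes because the entry has mean zero. *)
Lemma lincomb_variance a r : uniq r ->
  (\int[P]_w (lincomb a r w ^+ 2)%:E = (s * \sum_(i <- r) a i ^+ 2)%:E)%E.
Proof.
elim: r => [_|i r IH /= /andP[ir ur]].
  under eq_integral do rewrite /lincomb big_nil expr0n.
  by rewrite integral0 big_nil mulr0.
have iUZ : independent2 P (lincomb a r) (U i).
  move=> C D mC mD; rewrite setIC muleC.
  exact: (independent_lincomb_cons _ ir).
pose F (z : R * R) := ((a i * z.2 + z.1) ^+ 2)%:E.
have mF : measurable_fun [set: R * R] F.
  apply/measurable_EFinP; apply: measurable_funX; apply: measurable_funD => //.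
  exact: measurable_funM.
have -> : (\int[P]_w (lincomb a (i :: r) w ^+ 2)%:E =
    \int[P]_w F (lincomb a r w, U i w))%E.
  by apply: eq_integral => w _; rewrite /lincomb big_cons.
rewrite (independent2_tonelli (measurable_lincomb a r) _ iUZ mF) //; last first.
  by move=> z; rewrite lee_fin sqr_ge0.
have Ui : integ P (U i) by apply: subgaussian_integ (sU i).
have U2i : integ P (fun w => U i w ^+ 2).
  by apply: subgaussian_integ_sqr (sU i).
have U0 : Ex P (U i) = 0 by apply: (@subgaussian_mean0 _ _ _ _ B).
transitivity (\int[P]_w ((a i ^+ 2 * s)%:E + (lincomb a r w ^+ 2)%:E))%E.
  apply: eq_integral => w _; set z := lincomb a r w; rewrite /F /=.
  pose G w' := a i ^+ 2 * U i w' ^+ 2 + (2 * a i * z * U i w' + z ^+ 2).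
  have Gi1 : integ P (fun w' => 2 * a i * z * U i w' + z ^+ 2).
    by apply: integD; [exact: integZ | exact: integ_cst].
  have Gi : integ P G by apply: integD => //; exact: integZ.
  transitivity (\int[P]_w' (G w')%:E)%E.
    by apply: eq_integral => w' _; congr EFin; rewrite /G; ring.
  rewrite ExE // -EFinD; congr EFin.
  rewrite ExD //; last exact: integZ.
  rewrite ExD //; [|exact: integZ|exact: integ_cst].
  by rewrite Ex_cst !ExZ // U0 mulr0 add0r varU.
have s0 : 0 <= s by rewrite -(varU i); apply: Ex_ge0 => w; exact: sqr_ge0.
rewrite ge0_integralD //; first last.
- by apply/measurable_EFinP; apply: measurable_funX; exact: measurable_lincomb.
- by move=> w _; rewrite lee_fin sqr_ge0.
- by move=> w _; rewrite lee_fin mulr_ge0 ?sqr_ge0.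
rewrite IH // big_cons mulrDr EFinD; congr (_ + _)%E.
have -> : (\int[P]__ (a i ^+ 2 * s)%:E = (a i ^+ 2 * s)%:E * P setT)%E.
  exact: integral_cst.
by rewrite probability_setT mule1 mulrC.
Qed.

End LinearCombinations.

Section RowSums.
Context {d : measure_display} {Omega : measurableType d} {R : realType}.
Variable P : probability Omega R.
Variables (k m : nat) (U : 'I_k * 'I_m -> {RV P >-> R}).
Hypothesis U_indep : mutually_independent U.
Variables (B s : R) (a : 'I_m -> R).
Hypotheses (B0 : 0 <= B) (sU : forall i, subgaussian P B (U i)).
Hypothesis varU : forall i, Ex P (fun w => U i w ^+ 2) = s.
Hypotheses (a_sub : B * \sum_j a j ^+ 2 <= 6) (a_var : s * \sum_j a j ^+ 2 = 1).

Let row (i : 'I_k) (w : Omega) := \sum_j a j * U (i, j) w.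

Let rowE i : row i =
  lincomb U (fun ij => a ij.2) [seq (i, j) | j <- index_enum 'I_m].
Proof. by apply/funext => w; rewrite /lincomb big_map. Qed.

Let uniq_row i :
  @uniq ('I_k * 'I_m)%type [seq (i, j) | j <- index_enum 'I_m].
Proof. by rewrite map_inj_uniq ?index_enum_uniq // => j j' []. Qed.

Let measurable_row i : measurable_fun [set: Omega] (row i).
Proof. by rewrite rowE; exact: measurable_lincomb. Qed.

Let row_mgf i h : `|h| <= 1 / 64 ->
  (\int[P]_w (expR (h * row i w ^+ 2))%:E <= (expR (h + 2 ^+ 15 * h ^+ 2))%:E)%E.
Proof.
apply: subgaussian_mgf_sqr => //.
  apply: subgaussian_le a_sub _; rewrite rowE.
  have := lincomb_subgaussian U_indep sU (fun ij => a ij.2) (uniq_row i).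
  by rewrite big_map.
rewrite /Ex rowE (lincomb_variance U_indep B0 sU varU _ (uniq_row i)) big_map.
by rewrite a_var.
Qed.

Lemma row_sum_mgf h (q : seq 'I_k) : uniq q -> `|h| <= 1 / 64 ->
  (\int[P]_w (expR (h * \sum_(i <- q) row i w ^+ 2))%:E
     <= (expR ((h + 2 ^+ 15 * h ^+ 2) * (size q)%:R))%:E)%E.
Proof.
move=> uq h64; elim: q uq => [_|i q IH /= /andP[iq uq]].
  rewrite mulr0 expR0; under eq_integral do rewrite big_nil mulr0 expR0.
  have := integral_cst P measurableT 1%:E; rewrite mul1e => ->.
  by rewrite probability_le1.
have -> : (\int[P]_w (expR (h * \sum_(i0 <- i :: q) row i0 w ^+ 2))%:E =
    \int[P]_w (expR (h * row i w ^+ 2) *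
               expR (h * \sum_(i0 <- q) row i0 w ^+ 2))%:E)%E.
  by apply: eq_integral => w _; rewrite big_cons -expRD mulrDr.
have ind : independent2 P (row i) (fun w => \sum_(i0 <- q) row i0 w ^+ 2).
  have := @independent2_disjoint _ _ _ P _ U U_indep [set ij | ij.1 == i]%SET
    [set ij | ij.1 \in q]%SET (fun x => \sum_j a j * x (i, j))
    (fun x => \sum_(i0 <- q) (\sum_j a j * x (i0, j)) ^+ 2).
  apply.
  - by move=> ij; rewrite !inE => /eqP ->.
  - apply: measurable_sum => j; apply: measurable_funM => //.
    by apply: measurable_coord; rewrite inE.
  - apply: measurable_sum_seq => i0 i0q; apply: measurable_funX.
    apply: measurable_sum => j; apply: measurable_funM => //.
    by apply: measurable_coord; rewrite inE.
rewrite (independent2_ge0_integralM (f := fun x => expR (h * x ^+ 2))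
  (g := fun x => expR (h * x))) //.
- have -> : (h + 2 ^+ 15 * h ^+ 2) * (size q).+1%:R =
      h + 2 ^+ 15 * h ^+ 2 + (h + 2 ^+ 15 * h ^+ 2) * (size q)%:R.
    by rewrite -natr1; ring.
  rewrite expRD EFinM; apply: lee_pmul.
  + by apply: integral_ge0 => w _; rewrite lee_fin expR_ge0.
  + by apply: integral_ge0 => w _; rewrite lee_fin expR_ge0.
  + exact: row_mgf.
  + exact: IH.
- by apply: measurable_sum => i0; exact: measurable_funX.
- by apply: measurableT_comp => //; exact: measurable_funM.
- by apply: measurableT_comp => //; exact: measurable_funM.
Qed.

Let S w := \sum_i row i w ^+ 2.

(** Chernoff's bound for both tails at once: [h] is kept on both sides of the event, which is an
    upper tail for [h > 0] and a lower tail for [h < 0]. *)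
Let S_tail (h c : R) : `|h| <= 1 / 64 ->
  (P [set w | (h * c <= h * S w)%R]
     <= (expR ((h + 2 ^+ 15 * h ^+ 2) * k%:R - h * c))%:E)%E.
Proof.
move=> h64; have := row_sum_mgf (index_enum_uniq 'I_k) h64.
rewrite -[index_enum _]enumT size_enum_ord enumT => le_mgf.
have mS : measurable_fun [set: Omega] (fun w => expR (h * S w)).
  apply: measurableT_comp => //; apply: measurable_funM => //.
  by apply: measurable_sum => i; exact: measurable_funX.
have [ei ec] := ge0_integ mS (fun w => expR_ge0 _) le_mgf.
have -> : [set w | h * c <= h * S w] = [set w | expR (h * c) <= expR (h * S w)].
  by apply/seteqP; split=> w /=; rewrite ler_expR.
apply: le_trans (markov_Ex ei (fun w => expR_ge0 _) (expR_gt0 _)) _.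
by rewrite lee_fin expRD expRN ler_pM2r ?invr_gt0 ?expR_gt0.
Qed.

Lemma row_sum_tails (eps : R) : 0 < eps -> eps < 1 ->
  (P [set w | (k%:R * (1 + eps) <= S w)%R]
     <= (expR (- (2 ^+ 17)^-1 * eps ^+ 2 * k%:R))%:E)%E /\
  (P [set w | (S w <= k%:R * (1 - eps))%R]
     <= (expR (- (2 ^+ 17)^-1 * eps ^+ 2 * k%:R))%:E)%E.
Proof.
(* This [h] minimizes [2^15 h^2 - h eps]; the minimum is [- eps^2 / 2^17]. *)
move=> e0 e1; pose h : R := eps / 2 ^+ 16.
have h0 : 0 < h by rewrite divr_gt0 // exprn_gt0.
have h64 : `|h| <= 1 / 64.
  rewrite ger0_norm ?(ltW h0) // /h ler_pdivrMr ?exprn_gt0 //.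
  have : (64 : R) <= 2 ^+ 16 by rewrite -[64]/(2 ^ 6)%:R natrX ler_eXn2l // ltr1n.
  lra.
split.
- have := S_tail (k%:R * (1 + eps)) h64.
  have -> : (h + 2 ^+ 15 * h ^+ 2) * k%:R - h * (k%:R * (1 + eps)) =
    - (2 ^+ 17)^-1 * eps ^+ 2 * k%:R by rewrite /h; field.
  have -> // : [set w | h * (k%:R * (1 + eps)) <= h * S w] =
    [set w | k%:R * (1 + eps) <= S w].
  by apply/seteqP; split=> w /=; rewrite ler_pM2l.
- have h64' : `|- h| <= 1 / 64 by rewrite normrN.
  have := S_tail (k%:R * (1 - eps)) h64'.
  have -> : (- h + 2 ^+ 15 * (- h) ^+ 2) * k%:R - - h * (k%:R * (1 - eps)) =
    - (2 ^+ 17)^-1 * eps ^+ 2 * k%:R by rewrite /h; field.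
  have -> // : [set w | - h * (k%:R * (1 - eps)) <= - h * S w] =
    [set w | S w <= k%:R * (1 - eps)].
  by apply/seteqP; split=> w /=; rewrite ler_nM2l ?oppr_lt0.
Qed.

End RowSums.

(** * Sub-Gaussian parameters and variances of the three entry laws *)

Section EntryLaws.
Context {d : measure_display} {Omega : measurableType d} {R : realType}.
Variable P : probability Omega R.
Implicit Type X : {RV P >-> R}.

Lemma integral_standard_normal X (f : R -> R) : standard_normal X ->
    measurable_fun [set: R] f -> (forall x, 0 <= f x) ->
  (\int[P]_w (f (X w))%:E = \int[normal_prob 0 1]_x (f x)%:E)%E.
Proof.
move=> nX mf f0.
have mX : measurable_fun [set: Omega] (X : Omega -> measurableTypeR R).
  exact: (measurable_funPT X).
pose X' : {mfun Omega >-> measurableTypeR R} := HB.pack (X : Omega -> measurableTypeR R)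
  (isMeasurableFun.Build _ _ Omega (measurableTypeR R) X mX).
transitivity (\int[distribution P X']_x (f x)%:E)%E.
  by rewrite ge0_integral_distribution //; exact/measurable_EFinP.
by apply: eq_measure_integral => A mA _; exact: nX.
Qed.

Lemma standard_normal_subgaussian X : standard_normal X ->
  subgaussian P (1 / 2) X.
Proof.
move=> nX t; rewrite (integral_standard_normal (f := fun x => expR (t * x))) //.
  by rewrite normal_exp_linear lee_fin ler_expR; lra.
by apply: measurableT_comp => //; exact: measurable_funM.
Qed.

(** Bounding [exp(u)] below by [1 + u] in the exact Gaussian integral gives
    [1 + (1 - q^2)/2 * V <= 1/q] for every [q > 0]. Both sides equal 1 at [q = 1], so their slopes
    there must agree, which means [V = 1]. *)
Lemma standard_normal_variance X : standard_normal X ->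
  Ex P (fun w => X w ^+ 2) = 1.
Proof.
move=> nX; have X2i : integ P (fun w => X w ^+ 2).
  by apply: subgaussian_integ_sqr (standard_normal_subgaussian nX).
set V := Ex P _.
have V0 : 0 <= V by apply: Ex_ge0 => w; exact: sqr_ge0.
have key q : 0 < q -> 1 + (1 - q ^+ 2) / 2 * V <= q^-1.
  move=> q0; have mE : measurable_fun [set: R]
      (fun x => expR ((1 - q ^+ 2) / 2 * x ^+ 2)).
    apply: measurableT_comp => //; apply: measurable_funM => //.
  have le_q : (\int[P]_w (expR ((1 - q ^+ 2) / 2 * X w ^+ 2))%:E
      <= (q^-1)%:E)%E.
    by rewrite (integral_standard_normal nX mE) ?normal_exp_square.
  have mEX : measurable_fun [set: Omega]
      (fun w => expR ((1 - q ^+ 2) / 2 * X w ^+ 2)).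
    exact: (measurableT_comp mE).
  have [ei ele] := ge0_integ mEX (fun w => expR_ge0 _) le_q.
  have l2 : integ P (fun w => (1 - q ^+ 2) / 2 * X w ^+ 2) by exact: integZ.
  apply: le_trans ele; rewrite -[X in X + _](Ex_cst P 1) -ExZ // -ExD //.
    apply: Ex_le => // [|w]; last exact: expR_ge1Dx.
    by apply: integD => //; exact: integ_cst.
  exact: integ_cst.
have [V1|V1|//] := ltgtP V 1.
(* A point above 1 where [2 - q (1 + q) V] is still positive: [q (1 + q) <= 3 - V], and
   [(3 - V) V < 2] for [V < 1]. *)
- pose q := 1 + (1 - V) / 4; have q0 : 0 < q by rewrite /q; lra.
  have := key q q0; rewrite -(ler_pM2l q0) mulfV ?gt_eqF // => h.
  have : (q - 1) * (2 - q * (1 + q) * V) <= 0 by lra.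
  rewrite pmulr_rle0; last by rewrite /q; lra.
  have : q * (1 + q) <= 2 + (1 - V) by rewrite /q; nra.
  by move=> h1 h2; nra.
(* With [t = 1 - q], one has [q (1 + q) >= 2 - 3 t] and [(2 - 3 t) V = V + 1 > 2]. *)
- pose q := 1 - (V - 1) / (3 * V).
  have e1 : (V - 1) / (3 * V) < 1 / 3 by rewrite ltr_pdivrMr; lra.
  have e0 : 0 < (V - 1) / (3 * V) by rewrite divr_gt0; lra.
  have q0 : 0 < q by rewrite /q; lra.
  have := key q q0; rewrite -(ler_pM2l q0) mulfV ?gt_eqF // => h.
  have h1 : (1 - q) * (q * (1 + q) * V - 2) <= 0 by lra.
  move: h1; rewrite pmulr_rle0; last by rewrite /q; lra.
  have Vd : V * ((V - 1) / (3 * V)) = (V - 1) / 3 by field; rewrite gt_eqF //; lra.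
  move=> h2; set t := (V - 1) / (3 * V) in e0 e1 Vd; have : 2 - 3 * t <= q * (1 + q).
    by rewrite /q -/t; nra.
  by move=> h3; nra.
Qed.

(** The listed atoms have total mass 1, so the complement of their union is negligible, and on the
    union the integral is a finite sum. *)
Lemma integral_finite_law X (vs : seq R) (p f : R -> R) : uniq vs ->
    (forall v, v \in vs -> P (X @^-1` [set v]) = (p v)%:E) ->
    \sum_(v <- vs) p v = 1 ->
    measurable_fun [set: R] f -> (forall x, 0 <= f x) ->
  (\int[P]_w (f (X w))%:E = (\sum_(v <- vs) p v * f v)%:E)%E.
Proof.
move=> uvs Pv p1 mf f0; pose A v := X @^-1` [set v].
have mA v : measurable (A v) by exact: measurable_funPTI.
pose D := \big[setU/set0]_(v <- vs) A v.
have mD : measurable D by exact: bigsetU_measurable.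
have on_D (g : R -> R) : measurable_fun [set: R] g -> (forall x, 0 <= g x) ->
    (\int[P]_(w in D) (g (X w))%:E = (\sum_(v <- vs) p v * g v)%:E)%E.
  move=> mg g0; have mgX : measurable_fun [set: Omega] (fun w => (g (X w))%:E).
    by apply/measurable_EFinP; exact: measurableT_comp.
  rewrite ge0_integral_bigsetU //; first last.
  - by move=> w _; rewrite lee_fin.
  - exact: measurable_funTS.
  - by move=> u v _ _ [w [<- <-]].
  rewrite -sumEFin [LHS]big_seq [RHS]big_seq; apply: eq_bigr => v vvs.
  transitivity (\int[P]_(w in A v) (cst (g v)%:E w))%E.
    by apply: eq_integral => w; rewrite inE => ->.
  rewrite integral_cst // EFinM muleC; congr (_ * _)%E.
  exact: Pv.
have PD : P D = 1%E.
  have := on_D (cst 1) (measurable_cst _) (fun=> ler01).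
  have -> : (\int[P]_(w in D) (cst (1 : R) (X w))%:E = 1%:E * P D)%E.
    exact: (integral_cst P mD 1%:E).
  by rewrite mul1e => ->; under eq_bigr do rewrite mulr1; rewrite p1.
have mfX : measurable_fun [set: Omega] (fun w => (f (X w))%:E).
  by apply/measurable_EFinP; exact: measurableT_comp.
have PN : P (~` D) = 0%E by rewrite probability_setC // PD subee.
rewrite (@ge0_negligible_integral _ _ _ _ _ (~` D)) //; first last.
- by move=> w _; rewrite lee_fin.
- exact: measurableC.
by rewrite setTD setCK on_D.
Qed.

Lemma symmetric_sign_integral X (f : R -> R) : symmetric_sign X ->
    measurable_fun [set: R] f -> (forall x, 0 <= f x) ->
  (\int[P]_w (f (X w))%:E = ((f 1 + f (- 1)) / 2)%:E)%E.
Proof.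
move=> [X1 XN1] mf f0.
rewrite (@integral_finite_law X [:: 1; - 1] (fun=> 1 / 2)) //.
- by congr EFin; rewrite !big_cons big_nil; field.
- by rewrite /= inE andbT; apply/negP => /eqP; lra.
- by move=> v; rewrite !inE => /orP[] /eqP ->.
- by rewrite !big_cons big_nil; field.
Qed.

Lemma symmetric_sign_subgaussian X : symmetric_sign X -> subgaussian P 2 X.
Proof.
move=> sX t; rewrite (symmetric_sign_integral (f := fun x => expR (t * x))) //.
  by rewrite lee_fin mulr1 mulrN1 cosh_le_expR.
by apply: measurableT_comp => //; exact: measurable_funM.
Qed.

Lemma symmetric_sign_variance X : symmetric_sign X ->
  Ex P (fun w => X w ^+ 2) = 1.
Proof.
move=> sX; rewrite /Ex (symmetric_sign_integral (f := fun x => x ^+ 2)) //=.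
- by rewrite sqrrN expr1n; lra.
- by move=> x; exact: sqr_ge0.
Qed.

Lemma sparse_sign_integral X (f : R -> R) : sparse_sign X ->
    measurable_fun [set: R] f -> (forall x, 0 <= f x) ->
  (\int[P]_w (f (X w))%:E = ((f 1 + 4 * f 0 + f (- 1)) / 6)%:E)%E.
Proof.
move=> [X1 X0 XN1] mf f0; pose p (v : R) : R := if v == 0 then 2 / 3 else 1 / 6.
have N1 : (- 1 == 0 :> R) = false by rewrite oppr_eq0 oner_eq0.
rewrite (@integral_finite_law X [:: 1; 0; - 1] p) //.
- congr EFin; rewrite !big_cons big_nil /p eqxx oner_eq0 N1.
  by field.
- have n1 : (1 == - 1 :> R) = false by apply/negP => /eqP; lra.
  by rewrite /= !inE oner_eq0 n1 eq_sym N1.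
- by move=> v; rewrite !inE /p => /or3P[] /eqP ->; rewrite ?eqxx ?oner_eq0 ?N1.
- by rewrite !big_cons big_nil /p eqxx oner_eq0 N1; field.
Qed.

Lemma sparse_sign_subgaussian X : sparse_sign X -> subgaussian P 2 X.
Proof.
move=> sX t; rewrite (sparse_sign_integral (f := fun x => expR (t * x))) //.
  rewrite lee_fin mulr1 mulrN1 mulr0 expR0; have := cosh_le_expR t.
  have : 1 <= expR (2 * t ^+ 2).
    by rewrite -[leLHS]expR0 ler_expR mulr_ge0 ?sqr_ge0.
  by lra.
by apply: measurableT_comp => //; exact: measurable_funM.
Qed.

Lemma sparse_sign_variance X : sparse_sign X ->
  Ex P (fun w => X w ^+ 2) = 1 / 3.
Proof.
move=> sX; rewrite /Ex (sparse_sign_integral (f := fun x => x ^+ 2)) //=.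
- by rewrite sqrrN expr1n expr0n /=; field.
- by move=> x; exact: sqr_ge0.
Qed.

End EntryLaws.

Section IndependentProjectors.
Context {d : measure_display} {Omega : measurableType d} {R : realType}.
Variable P : probability Omega R.

(** The rate is the one found in [row_sum_tails]. Subspace projectors reach 1/16 and 1/8 and are
    weakened to it, so that all types enter the union bound alike. *)
Definition concentrated k m (T : Omega -> 'M[R]_(k, m)) : Prop :=
  forall (y : 'cV[R]_m) (eps : R), dotp y y = 1 -> 0 < eps -> eps < 1 ->
  (P [set w | (1 + eps <= dotp (T w *m y) (T w *m y))%R]
     <= (expR (- (2 ^+ 17)^-1 * eps ^+ 2 * k%:R))%:E)%E /\
  (P [set w | (dotp (T w *m y) (T w *m y) <= 1 - eps)%R]
     <= (expR (- (2 ^+ 17)^-1 * eps ^+ 2 * k%:R))%:E)%E.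

Lemma independent_entries_concentrated k m (c B s : R)
    (law : {RV P >-> R} -> Prop) (T : Omega -> 'M[R]_(k, m)) :
    (0 < k)%N -> 0 <= B -> B <= 6 * s -> c ^+ 2 * k%:R * s = 1 ->
    (forall X, law X -> subgaussian P B X /\ Ex P (fun w => X w ^+ 2) = s) ->
    scaled_independent_entries c law T ->
  random_matrix T /\ concentrated T.
Proof.
move=> k0 B0 Bs cks lawP [U [iU lU TE]]; split.
  move=> i j; under eq_fun do rewrite TE !mxE; exact: measurable_funM.
move=> y eps yy e0 e1.
have kR : (0 : R) < k%:R by rewrite ltr0n.
(* Coefficients that give each row sum variance 1 and make the sum of their squares over the rows
   equal to [k] times the squared norm of [T w *m y]. *)
pose a (j : 'I_m) := c * Num.sqrt k%:R * y j 0.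
have a2 : \sum_j a j ^+ 2 = c ^+ 2 * k%:R.
  rewrite /a; under eq_bigr do rewrite exprMn.
  rewrite -mulr_sumr exprMn sqr_sqrtr ?(ltW kR) // -[RHS]mulr1 -yy dotpE.
  by congr (_ * _); apply: eq_bigr => j _; rewrite expr2.
have sU i : subgaussian P B (U i) := (lawP _ (lU i)).1.
have vU i : Ex P (fun w => U i w ^+ 2) = s := (lawP _ (lU i)).2.
have a_var : s * \sum_j a j ^+ 2 = 1 by rewrite a2 mulrC.
have a_sub : B * \sum_j a j ^+ 2 <= 6.
  have -> : (6 : R) = 6 * s * (\sum_j a j ^+ 2) by rewrite -mulrA a_var mulr1.
  by apply: ler_wpM2r => //; apply: sumr_ge0 => j _; exact: sqr_ge0.
have := row_sum_tails iU B0 sU vU a_sub a_var e0 e1.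
have SE w : \sum_i (\sum_j a j * U (i, j) w) ^+ 2 =
    k%:R * dotp (T w *m y) (T w *m y).
  rewrite dotpE mulr_sumr; apply: eq_bigr => i _.
  have -> : \sum_j a j * U (i, j) w = Num.sqrt k%:R * (T w *m y) i 0.
    rewrite mxE mulr_sumr; apply: eq_bigr => j _.
    by rewrite TE !mxE /a; ring.
  by rewrite exprMn sqr_sqrtr ?(ltW kR) // expr2.
have -> : [set w | k%:R * (1 + eps) <= \sum_i (\sum_j a j * U (i, j) w) ^+ 2] =
    [set w | 1 + eps <= dotp (T w *m y) (T w *m y)].
  by apply/seteqP; split=> w /=; rewrite SE ler_pM2l.
have -> // : [set w | \sum_i (\sum_j a j * U (i, j) w) ^+ 2 <= k%:R * (1 - eps)] =
    [set w | dotp (T w *m y) (T w *m y) <= 1 - eps].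
by apply/seteqP; split=> w /=; rewrite SE ler_pM2l.
Qed.

Lemma independent_projector_concentrated k m (T : Omega -> 'M[R]_(k, m)) :
  (0 < k)%N ->
  [\/ scaled_independent_entries (1 / Num.sqrt k%:R) (@standard_normal _ _ _ P) T,
      scaled_independent_entries (1 / Num.sqrt k%:R) (@symmetric_sign _ _ _ P) T
    | scaled_independent_entries (Num.sqrt (3 / k%:R)) (@sparse_sign _ _ _ P) T] ->
  random_matrix T /\ concentrated T.
Proof.
move=> k0; have kR : (0 : R) < k%:R by rewrite ltr0n.
have c1 : (1 / Num.sqrt k%:R) ^+ 2 * k%:R * 1 = 1 :> R.
  by rewrite expr_div_n sqr_sqrtr ?(ltW kR) // expr1n; field; rewrite gt_eqF.
have c3 : Num.sqrt (3 / k%:R) ^+ 2 * k%:R * (1 / 3) = 1 :> R.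
  by rewrite sqr_sqrtr ?divr_ge0 ?(ltW kR) //; field; rewrite gt_eqF.
case.
- apply: (independent_entries_concentrated (B := 1 / 2) (s := 1)) => //; [lra..|].
  by move=> X nX; split; [exact: standard_normal_subgaussian
                         |exact: standard_normal_variance].
- apply: (independent_entries_concentrated (B := 2) (s := 1)) => //; [lra..|].
  by move=> X nX; split; [exact: symmetric_sign_subgaussian
                         |exact: symmetric_sign_variance].
- apply: (independent_entries_concentrated (B := 2) (s := 1 / 3)) => //; [lra..|].
  by move=> X nX; split; [exact: sparse_sign_subgaussian
                         |exact: sparse_sign_variance].
Qed.

End IndependentProjectors.

(** * Uniformly distributed subspaces *)

Section UniformSubspaces.
Context {R : realType}.

(* Householder reflection. *)
Lemma orthogonal_transitive m (y y' : 'cV[R]_m) :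
    dotp y y = 1 -> dotp y' y' = 1 ->
  exists2 O : 'M[R]_m, O *m O^T = 1%:M & O^T *m y = y'.
Proof.
move=> yy yy'; pose v := y - y'.
have vv : dotp v v = 2 * dotp v y.
  rewrite !(dotpDl, dotpDr, dotpNl, dotpNr) yy yy' (dotpC y y'); ring.
have [v0|v0] := eqVneq v 0.
  exists 1%:M; first by rewrite trmx1 mulmx1.
  by rewrite trmx1 mul1mx; apply/eqP; rewrite -subr_eq0 -/v v0.
have vv0 : dotp v v != 0 by apply: contraNneq v0 => /dotp_eq0 ->.
have vy0 : dotp v y != 0 by apply: contraNneq vv0 => h; rewrite vv h mulr0.
have vvE : v^T *m v = (dotp v v)%:M by rewrite [LHS]mx11_scalar.
have vyE : v^T *m y = (dotp v y)%:M by rewrite [LHS]mx11_scalar.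
pose H := v *m v^T; pose O : 'M[R]_m := 1%:M - (dotp v y)^-1 *: H.
have OT : O^T = O.
  by rewrite /O linearB linearZ /= trmx1 trmx_mul trmxK.
have HH : H *m H = dotp v v *: H.
  by rewrite /H mulmxA -(mulmxA v) vvE mul_mx_scalar -scalemxAl.
exists O; rewrite OT.
  rewrite /O mulmxBl !mulmxBr !mul1mx !mulmx1 -scalemxAl -scalemxAr HH !scalerA.
  have -> : (dotp v y)^-1 / dotp v y * dotp v v = 2 * (dotp v y)^-1.
    by rewrite vv; field.
  rewrite mulr_natl mulr2n scalerDl.
  by rewrite opprB addrK subrK.
rewrite /O mulmxBl mul1mx -scalemxAl /H -mulmxA vyE mul_mx_scalar scalerA.
by rewrite mulVf // scale1r /v opprB addrC subrK.
Qed.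

(** [same_law] compares probabilities of Borel sets of matrices only. The quadratic form is
    continuous in the matrix, so its events are among them. *)
Lemma quadratic_form_borel m (y : 'cV[R]_m) (C : set R) : measurable C ->
  <<s open >> [set M : 'M[R]_m | C (dotp y (M *m y))].
Proof.
move=> mC; pose f (M : g_sigma_algebraType (@open 'M[R]_m)) := dotp y (M *m y).
have fc : continuous (fun M : 'M[R]_m => dotp y (M *m y)).
  have -> : (fun M : 'M[R]_m => dotp y (M *m y)) =
      (fun M => \sum_i y i 0 * \sum_j M i j * y j 0).
    apply/funext => M; rewrite dotpE; apply: eq_bigr => i _; congr (_ * _).
    by rewrite mxE.
  move=> M; apply: (cvg_big _ (nbhs_filter M)) => [|i _].
    exact: add_continuous.
  apply: cvgMr; apply: (cvg_big _ (nbhs_filter M)) => [|j _].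
    exact: add_continuous.
  apply: cvgMl; exact: coord_continuous.
have mf : measurable_fun [set: g_sigma_algebraType (@open 'M[R]_m)] f.
  apply: (measurability (@RGenOpens.G R)); first exact: RGenOpens.measurableE.
  move=> _ [_ [a [b ->]] <-]; rewrite setTI.
  apply: sub_sigma_algebra; move/continuousP: fc; apply.
  exact: interval_open.
by have := mf measurableT C mC; rewrite setTI.
Qed.

Lemma bin2R (p : nat) : 'C(p.+1, 2)%:R = p.+1%:R * p%:R / 2 :> R.
Proof.
have := congr1 (fun n => n%:R : R) (bin_ffact p.+1 2).
by rewrite ffactnS ffactn1 /= !natrM => <-; rewrite mulfK // pnatr_eq0.
Qed.

(** A term in [t^2] takes [c] from one factor or [b] from two. At [p = 0] the binomial coefficient
    vanishes, so the truncated [p.-1] does no harm. *)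
Lemma coef2_trinomial_exp (a b c : R) (p : nat) :
  ((a%:P + b *: 'X + c *: 'X^2) ^+ p.+1)`_2 =
    p.+1%:R * a ^+ p * c + 'C(p.+1, 2)%:R * a ^+ p.-1 * b ^+ 2.
Proof.
set F := _ + _.
have F0 : F`_0 = a by rewrite /F !coefE /= !mulr0 !addr0.
have F1 : F`_1 = b by rewrite /F !coefE /= mulr1 mulr0 add0r addr0.
have F2 : F`_2 = c by rewrite /F !coefE /= mulr0 mulr1 !add0r.
have c0 q : (F ^+ q)`_0 = a ^+ q.
  elim: q => [|q IH]; first by rewrite !expr0 coefC.
  by rewrite !exprS coefM big_ord1 F0 IH.
have c1 q : (F ^+ q)`_1 = q%:R * a ^+ q.-1 * b.
  elim: q => [|q IH]; first by rewrite expr0 coefC /= !mul0r.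
  rewrite exprS coefM !big_ord_recl big_ord0 /= F0 F1 c0 IH addr0.
  case: q {IH} => [|q] /=; first by rewrite expr0; ring.
  by rewrite -[q.+2%:R]natr1 exprS; ring.
elim: p => [|p IH].
  by rewrite expr1 F2 bin_small // !expr0; ring.
rewrite exprS coefM !big_ord_recl big_ord0 /= F0 F1 F2 c0 c1 IH addr0 /=.
have -> : 'C(p.+2, 2)%:R = 'C(p.+1, 2)%:R + p.+1%:R :> R.
  by rewrite binS natrD bin1.
rewrite -[p.+2%:R]natr1.
case: p {IH} => [|p] /=; first by rewrite bin_small // !expr0 expr1; ring.
by rewrite !exprS; ring.
Qed.

Lemma eq_poly_horner (p q : {poly R}) : (forall t, p.[t] = q.[t]) -> p = q.
Proof.
move=> pq; apply/eqP; rewrite -subr_eq0; apply/eqP.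
apply: (@roots_geq_poly_eq0 _ _ [seq (i%:R : R) | i <- iota 0 (size (p - q))]).
- by apply/allP => _ /mapP[i _ ->]; rewrite rootE hornerD hornerN pq subrr.
- by rewrite map_inj_uniq ?iota_uniq // => i j /eqP; rewrite eqr_nat => /eqP.
- by rewrite size_map size_iota.
Qed.

End UniformSubspaces.

Section BoundedFunctions.
Context {d : measure_display} {Omega : measurableType d} {R : realType}.
Variable P : probability Omega R.
Implicit Types f g : Omega -> R.

(** Unlike [integ], this class is closed under products. It contains the entries of a random
    orthogonal projection, so every polynomial in them is integrable. *)
Definition bdd_measurable f :=
  measurable_fun [set: Omega] f /\ exists K, forall w, `|f w| <= K.

Lemma bdd_measurable_cst (c : R) : bdd_measurable (fun=> c).
Proof. by split; [exact: measurable_cst | exists `|c|]. Qed.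

Lemma bdd_measurableD f g : bdd_measurable f -> bdd_measurable g ->
  bdd_measurable (fun w => f w + g w).
Proof.
move=> [mf [K fK]] [mg [L gL]]; split; first exact: measurable_funD.
by exists (K + L) => w; rewrite (le_trans (ler_normD _ _)) // lerD.
Qed.

Lemma bdd_measurableM f g : bdd_measurable f -> bdd_measurable g ->
  bdd_measurable (fun w => f w * g w).
Proof.
move=> [mf [K fK]] [mg [L gL]]; split; first exact: measurable_funM.
by exists (K * L) => w; rewrite normrM ler_pM.
Qed.

Lemma bdd_measurable_sum (I : Type) (r : seq I) (F : I -> Omega -> R) :
  (forall i, bdd_measurable (F i)) ->
  bdd_measurable (fun w => \sum_(i <- r) F i w).
Proof.
move=> Fi; elim: r => [|i r IH].
  by under eq_fun do rewrite big_nil; exact: bdd_measurable_cst.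
by under eq_fun do rewrite big_cons; exact: bdd_measurableD.
Qed.

Lemma bdd_measurableX f p : bdd_measurable f ->
  bdd_measurable (fun w => f w ^+ p).
Proof.
move=> bf; elim: p => [|p IH].
  by under eq_fun do rewrite expr0; exact: bdd_measurable_cst.
by under eq_fun do rewrite exprS; exact: bdd_measurableM.
Qed.

Lemma bdd_measurable_integ f : bdd_measurable f -> integ P f.
Proof. by move=> [mf [K fK]]; apply: integ_dom (integ_cst P K) _. Qed.

Lemma bdd_measurable_coef_exp (F : Omega -> {poly R}) p :
  (forall i, bdd_measurable (fun w => (F w)`_i)) ->
  forall i, bdd_measurable (fun w => (F w ^+ p)`_i).
Proof.
move=> bF; elim: p => [|p IH] i.
  by under eq_fun do rewrite expr0; exact: bdd_measurable_cst.
under eq_fun do rewrite exprS coefM.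
by apply: bdd_measurable_sum => j; exact: bdd_measurableM.
Qed.

End BoundedFunctions.

(** * Moments of the quadratic form of an invariant random projection *)

Section ProjectionMoments.
Context {d : measure_display} {Omega : measurableType d} {R : realType}.
Variable P : probability Omega R.
Variables (m r : nat) (Pi : Omega -> 'M[R]_m).
Hypothesis mPi : forall i j, measurable_fun [set: Omega] (fun w => Pi w i j).
Hypothesis PiT : forall w, (Pi w)^T = Pi w.
Hypothesis PiPi : forall w, Pi w *m Pi w = Pi w.
Hypothesis trPi : forall w, \tr (Pi w) = r%:R.

Let q (y : 'cV[R]_m) w := dotp y (Pi w *m y).

Hypothesis Pi_inv : forall (y y' : 'cV[R]_m) (C : set R),
  dotp y y = 1 -> dotp y' y' = 1 -> measurable C ->
  P (q y @^-1` C) = P (q y' @^-1` C).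

(** The squares of all entries of a symmetric idempotent matrix add up to its trace, here [r]. *)
Let Pi_entry_bdd i j : bdd_measurable (fun w => Pi w i j).
Proof.
split=> //; exists (1 + r%:R) => w.
have le_tr : Pi w i j ^+ 2 <= r%:R.
  have PiiE l : Pi w l l = \sum_a Pi w l a ^+ 2.
    rewrite -[in LHS]PiPi -[X in (_ *m X) l l]PiT mxE.
    by apply: eq_bigr => a _; rewrite mxE expr2.
  rewrite -(trPi w) /mxtrace (bigD1 i) //= PiiE (bigD1 j) //= -addrA lerDl.
  rewrite addr_ge0 //; first by apply: sumr_ge0 => a _; exact: sqr_ge0.
  by apply: sumr_ge0 => l _; rewrite PiiE; apply: sumr_ge0 => a _; exact: sqr_ge0.
have := sqr_ge0 (`|Pi w i j| - 1); rewrite sqrrB real_normK ?num_real //.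
by have := normr_ge0 (Pi w i j); lra.
Qed.

Let Piy_bdd (y : 'cV[R]_m) i : bdd_measurable (fun w => (Pi w *m y) i 0).
Proof.
under eq_fun do rewrite mxE.
apply: bdd_measurable_sum => j; apply: bdd_measurableM => //.
exact: bdd_measurable_cst.
Qed.

Let q_bdd y : bdd_measurable (q y).
Proof.
rewrite /q; under eq_fun do rewrite dotpE.
apply: bdd_measurable_sum => j; apply: bdd_measurableM => //.
exact: bdd_measurable_cst.
Qed.

Let qE y w : q y w = dotp (Pi w *m y) (Pi w *m y).
Proof. by rewrite /q -[in LHS]PiPi /dotp trmx_mul PiT !mulmxA. Qed.

Let q_ge0 y w : 0 <= q y w.
Proof. by rewrite qE dotp_ge0. Qed.

Variable e : 'cV[R]_m.
Hypothesis ee : dotp e e = 1.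

Definition proj_moment p := Ex P (fun w => dotp e (Pi w *m e) ^+ p).

Let moment_unit y p : dotp y y = 1 -> Ex P (fun w => q y w ^+ p) = proj_moment p.
Proof.
move=> yy; rewrite /proj_moment -/(q e) /Ex; congr fine.
have mq z : measurable_fun [set: Omega] (q z) := (q_bdd z).1.
pose Q z : {mfun Omega >-> R} := HB.pack (q z) (isMeasurableFun.Build _ _ _ _ _ (mq z)).
(* The law of [q z] lives on the whole line, where [x ^+ p] may be negative; the absolute value
   makes the integrand nonnegative and changes nothing on the values of [q z]. *)
have tr z : (\int[P]_w (q z w ^+ p)%:E =
    \int[distribution P (Q z)]_x (`|x| ^+ p)%:E)%E.
  rewrite ge0_integral_distribution //.
  - by apply: eq_integral => w _ /=; rewrite ger0_norm.
  - by apply/measurable_EFinP; apply: measurable_funX; exact: normr_measurable.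
rewrite !tr; apply: eq_measure_integral => C mC _; exact: Pi_inv.
Qed.

Let moment_homogeneous x p :
  Ex P (fun w => q x w ^+ p) = proj_moment p * dotp x x ^+ p.
Proof.
have [->|x0] := eqVneq x 0.
  rewrite dotp0r /q; case: p => [|p]; first by rewrite mulr1.
  rewrite expr0n mulr0; under eq_fun do rewrite mulmx0 dotp0r expr0n.
  exact: Ex_cst.
have nx := enorm_gt0 x0; pose y := (enorm x)^-1 *: x.
have yy : dotp y y = 1.
  by rewrite dotpZl dotpZr -enorm_sqr; field; rewrite gt_eqF.
rewrite -(moment_unit p yy) mulrC -ExZ; last first.
  exact/bdd_measurable_integ/bdd_measurableX.
congr Ex; apply/funext => w; rewrite -exprMn; congr (_ ^+ _).
rewrite /q /y -scalemxAr dotpZl dotpZr -enorm_sqr.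
by field; rewrite gt_eqF.
Qed.

Let trinomial (a b c : R) : {poly R} := a%:P + b *: 'X + c *: 'X^2.

Let trinomial_horner a b c t : (trinomial a b c).[t] = a + b * t + c * t ^+ 2.
Proof. by rewrite /trinomial !hornerE. Qed.

Let size_trinomial a b c p : (size (trinomial a b c ^+ p) <= (2 * p).+1)%N.
Proof.
elim: p => [|p IH]; first by rewrite expr0 size_poly1.
have s3 : (size (trinomial a b c) <= 3)%N.
  rewrite /trinomial (leq_trans (size_polyD _ _)) // geq_max.
  rewrite (leq_trans (size_polyD _ _)) ?geq_max.
    rewrite (leq_trans (size_scale_leq _ _)) ?size_polyXn //.
  by rewrite (leq_trans (size_polyC_leq1 _)) //= (leq_trans (size_scale_leq _ _)) ?size_polyX.
rewrite exprS (leq_trans (size_polyMleq _ _)) // mulnS.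
by have := leq_add s3 IH; case: (_ + _)%N.
Qed.

(** Half the Laplacian of the expected [(p + 1)]-st power is computed in two ways. [F i w] and [G i]
    are the polynomials in t of the quadratic form and of the squared norm along [e + t e_i]. In the
    sum over i, the diagonal of [Pi] gives its trace [r], and the squares of the coordinates of
    [Pi e] give back the quadratic form at [e], hence the [p]-th moment. *)
Lemma proj_moment_rec p :
  (r%:R + 2 * p%:R) * proj_moment p = (m%:R + 2 * p%:R) * proj_moment p.+1.
Proof.
pose F i w := trinomial (q e w) (2 * (Pi w *m e) i 0) (Pi w i i).
pose G i := trinomial 1 (2 * e i 0) 1.
have bF i j : bdd_measurable (fun w => (F i w)`_j).
  rewrite /F /trinomial; under eq_fun do rewrite !coefE.
  apply: bdd_measurableD; first apply: bdd_measurableD.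
  - by case: j => [|j] /=; [exact: q_bdd | exact: bdd_measurable_cst].
  - apply: bdd_measurableM; last exact: bdd_measurable_cst.
    by apply: bdd_measurableM => //; exact: bdd_measurable_cst.
  - by apply: bdd_measurableM => //; exact: bdd_measurable_cst.
have bFX i j : bdd_measurable (fun w => (F i w ^+ p.+1)`_j).
  exact: bdd_measurable_coef_exp.
have iFX i j : integ P (fun w => (F i w ^+ p.+1)`_j).
  exact: bdd_measurable_integ.
have FG i : Ex P (fun w => (F i w ^+ p.+1)`_2) =
    proj_moment p.+1 * (G i ^+ p.+1)`_2.
  (* Taking expectations coefficientwise gives a polynomial again, so an identity valid at every
     real t passes to the coefficient of [t^2]. *)
  pose E := \poly_(j < (2 * p.+1).+1) Ex P (fun w => (F i w ^+ p.+1)`_j).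
  have -> : Ex P (fun w => (F i w ^+ p.+1)`_2) = E`_2.
    by rewrite coef_poly mulnS.
  suff -> : E = proj_moment p.+1 *: G i ^+ p.+1 by rewrite coefZ.
  apply: eq_poly_horner => t.
  rewrite hornerZ horner_exp trinomial_horner horner_poly.
  pose x := e + t *: delta_mx i 0.
  have d1 (z : 'cV[R]_m) : dotp z (delta_mx i 0) = z i 0.
    by rewrite /dotp -colE !mxE.
  have xx : dotp x x = 1 + 2 * e i 0 * t + 1 * t ^+ 2.
    have dd : (delta_mx i 0 : 'cV[R]_m) i 0 = 1 by rewrite mxE !eqxx.
    rewrite !(dotpDl, dotpDr, dotpZl, dotpZr) ee (dotpC (delta_mx i 0)) !d1 dd.
    by ring.
  rewrite -xx -moment_homogeneous.
  transitivity (Ex P (fun w =>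
      \sum_(j < (2 * p.+1).+1) t ^+ j * (F i w ^+ p.+1)`_j)).
    rewrite Ex_sum => [|j]; last exact: integZ.
    by apply: eq_bigr => j _; rewrite ExZ // mulrC.
  congr Ex; apply/funext => w.
  have -> : q x w = (F i w).[t].
    rewrite trinomial_horner /q /x.
    have sym : dotp e (Pi w *m delta_mx i 0) = (Pi w *m e) i 0.
      by rewrite -d1 /dotp trmx_mul PiT mulmxA.
    have dd : dotp (delta_mx i 0) (Pi w *m delta_mx i 0) = Pi w i i.
      by rewrite dotpC d1 -colE mxE.
    rewrite mulmxDr -scalemxAr !(dotpDl, dotpDr, dotpZl, dotpZr) sym dd.
    by rewrite (dotpC (delta_mx i 0)) d1; ring.
  rewrite -horner_exp (horner_coef_wide _ (size_trinomial _ _ _ _)).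
  by apply: eq_bigr => j _; rewrite mulrC.
have sumF w : \sum_i (F i w ^+ p.+1)`_2 =
    p.+1%:R * (r%:R + 2 * p%:R) * q e w ^+ p.
  under eq_bigr do rewrite coef2_trinomial_exp.
  rewrite big_split /= -!mulr_sumr.
  have -> : \sum_i Pi w i i = r%:R := trPi w.
  have -> : \sum_i (2 * (Pi w *m e) i 0) ^+ 2 = 4 * q e w.
    rewrite qE dotpE mulr_sumr; apply: eq_bigr => i _.
    by rewrite exprMn; ring.
  case: p {bFX iFX FG} => [|p0]; first by rewrite bin_small // expr0; ring.
  by rewrite bin2R /= [q e w ^+ p0.+1]exprS; field.
have sumG : \sum_i (G i ^+ p.+1)`_2 = p.+1%:R * (m%:R + 2 * p%:R).
  under eq_bigr do rewrite coef2_trinomial_exp.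
  rewrite big_split /= -!mulr_sumr sumr_const card_ord !expr1n bin2R.
  have -> : \sum_i (2 * e i 0) ^+ 2 = 4 * dotp e e.
    by rewrite dotpE mulr_sumr; apply: eq_bigr => i _; ring.
  by rewrite ee; field.
have p0 : (0 : R) < p.+1%:R by rewrite ltr0n.
apply: (mulfI (lt0r_neq0 p0)); rewrite !mulrA -sumG.
have iq : integ P (fun w => q e w ^+ p).
  exact/bdd_measurable_integ/bdd_measurableX.
rewrite -ExZ // mulr_suml.
under eq_bigr do rewrite mulrC -FG.
by rewrite -Ex_sum //; congr Ex; apply/funext => w; rewrite sumF.
Qed.

Let proj_moment_ge0 p : 0 <= proj_moment p.
Proof. by apply: Ex_ge0 => w; exact/exprn_ge0/q_ge0. Qed.

(** The [p]-th moment is the product of the ratios [(r + 2i) / (m + 2i)] over [i < p]. Each is at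
    most [a exp(- delta)], and Markov's inequality for the [p]-th power cancels [a ^ p]. *)
Lemma proj_tail (a delta : R) (p : nat) : (0 < m)%N -> 0 < a ->
    (forall i, (i < p)%N ->
      r%:R + 2 * i%:R <= (m%:R + 2 * i%:R) * (a * expR (- delta))) ->
  (P [set w | (a <= dotp e (Pi w *m e))%R] <= (expR (- delta * p%:R))%:E)%E.
Proof.
move=> m0 a0 le_a; have b0 : 0 <= a * expR (- delta).
  by rewrite mulr_ge0 ?expR_ge0 // ltW.
have le_mom : proj_moment p <= (a * expR (- delta)) ^+ p.
  elim: p le_a => [_|p IH le_a].
    rewrite expr0 /proj_moment; under eq_fun do rewrite expr0.
    by rewrite Ex_cst.
  have c0 : 0 < m%:R + 2 * p%:R :> R by rewrite ltr_pwDl ?ltr0n ?mulr_ge0.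
  rewrite -(ler_pM2l c0) -proj_moment_rec exprS mulrA.
  apply: ler_pM.
  - by rewrite addr_ge0 ?mulr_ge0.
  - exact: proj_moment_ge0.
  - exact: le_a.
  - by apply: IH => i ip; exact/le_a/ltnW.
have iq : integ P (fun w => q e w ^+ p).
  exact/bdd_measurable_integ/bdd_measurableX.
apply: (@le_trans _ _ (P [set w | (a ^+ p <= q e w ^+ p)%R])).
  apply: le_measure; rewrite ?inE.
  - by apply: measurable_ge_set; exact: (q_bdd e).1.
  - by apply: measurable_ge_set; exact: integ_measurable iq.
  - move=> w /= aq; case: p {le_a le_mom iq} => [|p]; first by rewrite !expr0.
    by rewrite ler_pXn2r ?nnegrE // ltW.
apply: le_trans (markov_Ex iq _ _) _.
- by move=> w; rewrite exprn_ge0.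
- by rewrite exprn_gt0.
rewrite lee_fin ler_pdivrMr ?exprn_gt0 // (le_trans le_mom) //.
by rewrite exprMn mulrC -expRM_natr.
Qed.

End ProjectionMoments.

Section SubspaceProjectors.
Context {d : measure_display} {Omega : measurableType d} {R : realType}.
Variable P : probability Omega R.

(** Conjugation by an orthogonal matrix whose transpose sends [y] to [y'] turns the form at [y] into
    the form at [y']. *)
Lemma uniform_row_space_quadratic k m (Q : Omega -> 'M[R]_(k, m))
    (y y' : 'cV[R]_m) (C : set R) : uniform_row_space P Q ->
    dotp y y = 1 -> dotp y' y' = 1 -> measurable C ->
  P ((fun w => dotp y ((Q w)^T *m Q w *m y)) @^-1` C) =
  P ((fun w => dotp y' ((Q w)^T *m Q w *m y')) @^-1` C).
Proof.
move=> uQ yy yy' mC; have [H HHT Hy] := orthogonal_transitive yy yy'.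
have := uQ H HHT _ (quadratic_form_borel y mC).
rewrite /preimage /= => ->; congr (P _); apply/funext => w; congr C.
by rewrite -Hy /dotp trmx_mul trmxK !mulmxA.
Qed.

Lemma subspace_projector_concentrated k m (T : Omega -> 'M[R]_(k, m)) :
  (0 < k)%N -> subspace_projector P T -> random_matrix T /\ concentrated P T.
Proof.
move=> k0 [km [Q [mQ QQ uQ TE]]]; split.
  by move=> i j; under eq_fun do rewrite TE mxE; exact: measurable_funM.
move=> y eps yy e0 e1.
have m0 : (0 < m)%N := leq_trans k0 km.
have kR : (0 : R) < k%:R by rewrite ltr0n.
have mR : (0 : R) < m%:R by rewrite ltr0n.
have kmR : (k%:R : R) <= m%:R by rewrite ler_nat.
pose Pi w := (Q w)^T *m Q w.
have mPi i j : measurable_fun [set: Omega] (fun w => Pi w i j).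
  rewrite /Pi; under eq_fun do rewrite mxE.
  apply: measurable_sum => l; apply: measurable_funM; last exact: mQ.
  by under eq_fun do rewrite mxE; exact: mQ.
have PiT w : (Pi w)^T = Pi w by rewrite /Pi trmx_mul trmxK.
have PiPi w : Pi w *m Pi w = Pi w.
  by rewrite /Pi mulmxA -(mulmxA _ (Q w)) QQ mulmx1.
have trPi w : \tr (Pi w) = k%:R by rewrite /Pi mxtrace_mulC QQ mxtrace1.
have Pi_inv (z z' : 'cV[R]_m) (C : set R) := @uniform_row_space_quadratic _ _ Q z z' C uQ.
pose Pi' w := 1%:M - Pi w.
have mPi' i j : measurable_fun [set: Omega] (fun w => Pi' w i j).
  have E w : Pi' w i j = 1%:M i j - Pi w i j by rewrite !mxE.
  under eq_fun do rewrite E.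
  by apply: measurable_funB => //; exact: measurable_cst.
have PiT' w : (Pi' w)^T = Pi' w by rewrite /Pi' linearB /= trmx1 PiT.
have PiPi' w : Pi' w *m Pi' w = Pi' w.
  by rewrite /Pi' mulmxBl !mulmxBr !mul1mx mulmx1 PiPi subrr subr0.
have trPi' w : \tr (Pi' w) = (m - k)%:R.
  by rewrite /Pi' raddfB /= mxtrace1 trPi natrB.
have q'E (z : 'cV[R]_m) w : dotp z (Pi' w *m z) = dotp z z - dotp z (Pi w *m z).
  by rewrite /Pi' mulmxBl mul1mx dotpDr dotpNr.
have Pi_inv' (z z' : 'cV[R]_m) (C : set R) :
    dotp z z = 1 -> dotp z' z' = 1 -> measurable C ->
    P ((fun w => dotp z (Pi' w *m z)) @^-1` C) =
    P ((fun w => dotp z' (Pi' w *m z')) @^-1` C).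
  move=> zz zz' mC; pose C' := (fun x : R => 1 - x) @^-1` C.
  have mC' : measurable C'.
    rewrite -[C']setTI; have : measurable_fun [set: R] (fun x : R => 1 - x).
      by apply: measurable_funB => //; exact: measurable_cst.
    by apply.
  have := Pi_inv z z' C' zz zz' mC'; rewrite /C' /preimage /=.
  under eq_set do rewrite -{1}zz -q'E.
  move=> ->; congr (P _); apply/funext => w /=; congr C.
  by rewrite q'E zz'.
have TyE w : dotp (T w *m y) (T w *m y) = m%:R / k%:R * dotp y (Pi w *m y).
  rewrite TE -scalemxAl dotpZl dotpZr mulrA -expr2 sqr_sqrtr ?divr_ge0 //.
  by congr (_ * _); rewrite /Pi /dotp trmx_mul !mulmxA.
pose u : R := k%:R / m%:R.
have u0 : 0 < u by rewrite divr_gt0.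
have u1 : u <= 1 by rewrite ler_pdivrMr // mul1r.
have ku : k%:R = u * m%:R by rewrite /u divfK // gt_eqF.
split.
(* As long as [4 i <= eps k], the moment ratio is at most [u (1 + eps/2)], which is below
   [(1 + eps) u (1 - eps/4)]; this fixes [delta = eps/4]. The successor ensures [p >= eps k / 4], so
   the exponent reaches [eps^2 k / 16]. *)
- pose p := (Num.truncn (eps * k%:R / 4)).+1.
  have t0 : 0 <= eps * k%:R / 4 by rewrite divr_ge0 // mulr_ge0 // ltW.
  have /andP[tl tr] := truncn_itv t0.
  have -> : [set w | 1 + eps <= dotp (T w *m y) (T w *m y)] =
      [set w | (1 + eps) * u <= dotp y (Pi w *m y)].
    apply/seteqP; split=> w /=; rewrite TyE /u -ler_pdivrMl ?divr_gt0 //;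
      by rewrite invf_div mulrC.
  have a0 : 0 < (1 + eps) * u by rewrite mulr_gt0 //; lra.
  apply: le_trans (proj_tail (delta := eps / 4) (p := p) mPi PiT PiPi trPi
    Pi_inv yy m0 a0 _) _.
    move=> i; rewrite ltnS -(ler_nat R) => ip.
    have i4 : 4 * i%:R <= eps * (u * m%:R) by rewrite -ku; lra.
    apply: (@le_trans _ _ (m%:R * ((1 + eps) * u * (1 - eps / 4)))).
      have : 0 <= u * m%:R * eps * (1 - eps).
        by rewrite !mulr_ge0 //; lra.
      by rewrite ku; lra.
    apply: ler_pM.
    + exact: ltW.
    + by rewrite !mulr_ge0 //; lra.
    + by rewrite lerDl mulr_ge0.
    + by rewrite ler_wpM2l ?(ltW a0) // (le_trans _ (expR_ge1Dx _)).
  rewrite lee_fin ler_expR !mulNr lerN2.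
  have : eps / 4 * (eps * k%:R / 4) <= eps / 4 * p%:R.
    by rewrite ler_wpM2l ?divr_ge0 ?(ltW e0) // ltW.
  apply: le_trans; have -> : eps / 4 * (eps * k%:R / 4) = 16^-1 * eps ^+ 2 * k%:R.
    by field.
  rewrite !ler_wpM2r ?sqr_ge0 // lef_pV2 ?posrE ?exprn_gt0 //.
  have -> : (16 : R) = 2 ^+ 4 by rewrite -natrX.
  by rewrite ler_eXn2l // ltr1n.
(* The ratio for the complement is [1 - k / (m + 2i)], at most [1 - u (1 - eps/2)] as long as
   [4 i <= eps m]. The number of moments is now proportional to [m], which compensates the factor
   [u] in [delta], because [u m = k]. *)
- pose p := (Num.truncn (eps * m%:R / 4)).+1.
  have t0 : 0 <= eps * m%:R / 4 by rewrite divr_ge0 // mulr_ge0 // ltW.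
  have /andP[tl tr] := truncn_itv t0.
  have -> : [set w | dotp (T w *m y) (T w *m y) <= 1 - eps] =
      [set w | 1 - u * (1 - eps) <= dotp y (Pi' w *m y)].
    apply/seteqP; split=> w /=; rewrite TyE q'E yy lerD2l lerN2 /u;
      by rewrite -ler_pdivlMl ?divr_gt0 // invf_div.
  have a0 : 0 < 1 - u * (1 - eps).
    have : u * (1 - eps) <= 1 * (1 - eps) by rewrite ler_wpM2r //; lra.
    lra.
  apply: le_trans (proj_tail (delta := u * eps / 2) (p := p) mPi' PiT' PiPi' trPi'
    Pi_inv' yy m0 a0 _) _.
    move=> i; rewrite ltnS -(ler_nat R) => ip.
    have i4 : 4 * i%:R <= eps * m%:R by lra.
    have ue : 0 <= u * eps by rewrite mulr_ge0 // ltW.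
    have h1 : 1 - u * (1 - eps / 2) <= (1 - u * (1 - eps)) * expR (- (u * eps / 2)).
      apply: (@le_trans _ _ ((1 - u * (1 - eps)) * (1 - u * eps / 2))).
        have : 0 <= u * (1 - eps) * (u * eps).
          by rewrite !mulr_ge0 //; lra.
        lra.
      by rewrite ler_wpM2l ?(ltW a0) // (le_trans _ (expR_ge1Dx _)).
    apply: (@le_trans _ _ ((m%:R + 2 * i%:R) * (1 - u * (1 - eps / 2)))).
      rewrite natrB // ku.
      have : 0 <= u * ((eps * m%:R - 4 * i%:R) + eps * (2 * i%:R)).
        rewrite mulr_ge0 ?(ltW u0) // addr_ge0 ?subr_ge0 //.
        by rewrite mulr_ge0 ?(ltW e0) // mulr_ge0.
      lra.
    by rewrite ler_wpM2l // addr_ge0 // mulr_ge0.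
  rewrite lee_fin ler_expR !mulNr lerN2.
  have : u * eps / 2 * (eps * m%:R / 4) <= u * eps / 2 * p%:R.
    by rewrite ler_wpM2l ?(ltW tr) // divr_ge0 // mulr_ge0 // ltW.
  apply: le_trans.
  have -> : u * eps / 2 * (eps * m%:R / 4) = 8^-1 * eps ^+ 2 * k%:R.
    by rewrite ku; field.
  rewrite !ler_wpM2r ?sqr_ge0 // lef_pV2 ?posrE ?exprn_gt0 //.
  have -> : (8 : R) = 2 ^+ 3 by rewrite -natrX.
  by rewrite ler_eXn2l // ltr1n.
Qed.

End SubspaceProjectors.

(** * Union bound *)

Section UnionBound.
Context {d : measure_display} {Omega : measurableType d} {R : realType}.
Variable P : probability Omega R.

Lemma measurable_lt_set (f g : Omega -> R) : measurable_fun [set: Omega] f ->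
  measurable_fun [set: Omega] g -> measurable [set w | f w < g w].
Proof.
move=> mf mg; have -> : [set w | f w < g w] = ~` [set w | g w <= f w].
  by apply/seteqP; split=> w /=; rewrite ltNge => /negP.
apply: measurableC; rewrite -[X in measurable X]setTI.
exact: measurable_fun_le.
Qed.

Lemma union_bound (I : Type) (r : seq I) (A : I -> set Omega) (x : R) :
    (forall i, measurable (A i)) -> (forall i, (P (A i) <= x%:E)%E) ->
  (P (\big[setU/set0]_(i <- r) A i) <= ((size r)%:R * x)%:E)%E.
Proof.
move=> mA PA; elim: r => [|i r IH]; first by rewrite big_nil measure0 mul0r.
rewrite big_cons /= (le_trans (measureU2 _ _ _)) //.
  exact: bigsetU_measurable.
have -> : (size r).+1%:R * x = x + (size r)%:R * x by rewrite -natr1; ring.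
by rewrite EFinD; apply: leeD; [exact: PA | exact: IH].
Qed.

(** Homogeneity reduces to unit vectors. The strict inequalities make the events empty at [v = 0], a
    case that does arise among differences of columns. *)
Lemma concentrated_all k m (T : Omega -> 'M[R]_(k, m)) (v : 'cV[R]_m) (eps : R) :
    random_matrix T -> concentrated P T -> 0 < eps -> eps < 1 ->
  [/\ measurable_fun [set: Omega] (fun w => dotp (T w *m v) (T w *m v)),
      (P [set w | ((1 + eps) * dotp v v < dotp (T w *m v) (T w *m v))%R]
        <= (expR (- (2 ^+ 17)^-1 * eps ^+ 2 * k%:R))%:E)%E
    & (P [set w | (dotp (T w *m v) (T w *m v) < (1 - eps) * dotp v v)%R]
        <= (expR (- (2 ^+ 17)^-1 * eps ^+ 2 * k%:R))%:E)%E].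
Proof.
move=> mT cT e0 e1.
have mq (z : 'cV[R]_m) :
    measurable_fun [set: Omega] (fun w => dotp (T w *m z) (T w *m z)).
  have mTz i : measurable_fun [set: Omega] (fun w => (T w *m z) i 0).
    under eq_fun do rewrite mxE.
    by apply: measurable_sum => j; apply: measurable_funM.
  under eq_fun do rewrite dotpE.
  by apply: measurable_sum => i; exact: measurable_funM.
have [->|v0] := eqVneq v 0.
  split; first exact: mq.
    rewrite (_ : [set _ | _] = set0) ?measure0 ?lee_fin ?expR_ge0 //.
    by apply/seteqP; split=> w //=; rewrite mulmx0 !dotp0r mulr0 ltxx.
  rewrite (_ : [set _ | _] = set0) ?measure0 ?lee_fin ?expR_ge0 //.
  by apply/seteqP; split=> w //=; rewrite mulmx0 !dotp0r mulr0 ltxx.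
have nv := enorm_gt0 v0; pose y := (enorm v)^-1 *: v.
have yy : dotp y y = 1.
  by rewrite dotpZl dotpZr -enorm_sqr; field; rewrite gt_eqF.
have vv0 : 0 < dotp v v by rewrite -enorm_sqr exprn_gt0.
have TyE w : dotp (T w *m v) (T w *m v) = dotp (T w *m y) (T w *m y) * dotp v v.
  rewrite -scalemxAr dotpZl dotpZr -(enorm_sqr v).
  by field; rewrite gt_eqF.
have [up lo] := cT y eps yy e0 e1.
split; first exact: mq.
- apply: le_trans up; apply: le_measure; rewrite ?inE.
  + by apply: measurable_lt_set => //; exact: measurable_cst.
  + by apply: measurable_ge_set; exact: mq.
  + by move=> w /=; rewrite TyE ltr_pM2r // => /ltW.
- apply: le_trans lo; apply: le_measure; rewrite ?inE.
  + by apply: measurable_lt_set => //; exact: measurable_cst.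
  + rewrite -[X in measurable X]setTI.
    exact: (measurable_fun_le measurableT (mq y) (measurable_cst _)).
  + by move=> w /=; rewrite TyE ltr_pM2r // => /ltW.
Qed.

End UnionBound.

(** * The probability bound for the cone event *)

Lemma random_projector_concentrated (R : realType) (d : measure_display)
    (Omega : measurableType d) (P : probability Omega R) (k m : nat)
    (T : Omega -> 'M[R]_(k, m)) : (0 < k)%N -> random_projector P T ->
  random_matrix T /\ concentrated P T.
Proof.
move=> k0 [pT|pT|pT|pT]; first exact: subspace_projector_concentrated.
- by apply: independent_projector_concentrated => //; apply: Or31.
- by apply: independent_projector_concentrated => //; apply: Or32.
- by apply: independent_projector_concentrated => //; apply: Or33.
Qed.

Theorem theorem3p4 (R : realType) :
  exists C : R, 0 < C /\
  forall (m n : nat) (A : 'M[R]_(m, n)) (b : 'cV[R]_m),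
    ~ cone A b ->
    enorm b = 1 ->
    (forall j : 'I_n, enorm (col j A) = 1) ->
  forall Delta : R, 0 < Delta -> Delta <= dist_cone A b ->
  forall eps : R, 0 < eps ->
    eps < Delta ^+ 2 / (mu A ^+ 2 + 2 * mu A * Num.sqrt (1 - Delta ^+ 2) + 1) ->
  forall k : nat, (0 < k)%N ->
  forall (d : measure_display) (Omega : measurableType d)
    (P : probability Omega R) (T : Omega -> 'M[R]_(k, m)),
    random_projector P T ->
    ((1 - 2 * (n%:R + 1) * (n%:R + 2)
          * expR (- C * (eps ^+ 2 - eps ^+ 3) * k%:R))%:E
      <= P [set w | ~ cone (T w *m A) (T w *m b)])%E.
Proof.
(* Half the rate of [concentrated]: the tail probabilities become [x ^+ 2], where [x] is the
   exponential at the halved rate. *)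
exists (2 ^+ 18)^-1; split; first by rewrite invr_gt0 exprn_gt0.
move=> m n A b nb b1 A1 Delta D0 Dd eps e0 elt k k0 d Omega P T pT.
have [mT cT] := random_projector_concentrated k0 pT.
have D1 : Delta ^+ 2 <= 1.
  have c0 : cone A 0 by apply/coneP; exists 0; split=> [j|]; rewrite ?mxE ?mulmx0.
  by have [h _] := cone_dotp_le b1 D0 Dd c0; lra.
(* [concentrated] asks for [eps < 1]; it holds because the numerator is at most 1 and the
   denominator at least 1. *)
have e1 : eps < 1.
  apply: lt_le_trans elt _; rewrite ler_pdivrMr; last first.
    by rewrite ltr_wpDl // addr_ge0 ?sqr_ge0 // !mulr_ge0 ?mu_ge0 ?sqrtr_ge0.
  rewrite mul1r (le_trans D1) // lerDr addr_ge0 ?sqr_ge0 //.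
  by rewrite !mulr_ge0 ?mu_ge0 ?sqrtr_ge0.
pose x := expR (- (2 ^+ 18)^-1 * eps ^+ 2 * k%:R) : R.
pose K : R := 2 * (n%:R + 1) * (n%:R + 2).
have n0 : 0 <= n%:R :> R by [].
have K0 : 0 <= K by rewrite !mulr_ge0 //; lra.
have x_le : x <= expR (- (2 ^+ 18)^-1 * (eps ^+ 2 - eps ^+ 3) * k%:R).
  rewrite ler_expR ler_wpM2r // !mulNr lerN2 ler_wpM2l ?invr_ge0 ?exprn_ge0 //.
  by rewrite gerBl exprn_ge0 // ltW.
have mcone : measurable [set w | cone (T w *m A) (T w *m b)].
  apply: measurable_cone => [i j|i].
    under eq_fun do rewrite mxE.
    by apply: measurable_sum => l; apply: measurable_funM.
  under eq_fun do rewrite mxE.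
  by apply: measurable_sum => l; apply: measurable_funM.
have mncone : measurable [set w | ~ cone (T w *m A) (T w *m b)].
  by rewrite (_ : [set _ | _] = ~` [set w | cone (T w *m A) (T w *m b)]) //;
     exact: measurableC.
apply: (@le_trans _ _ (1 - K * x)%:E).
  by rewrite lee_fin -/K lerD2l lerN2 ler_wpM2l.
(* When K x >= 1 the bound is void; otherwise x ^ 2 absorbs the number of
   events in the union bound. *)
have [Kx|Kx] := leP 1 (K * x).
  by apply: le_trans (measure_ge0 _ _); rewrite lee_fin; lra.
have x0 : 0 < x by exact: expR_gt0.
have x2 : expR (- (2 ^+ 17)^-1 * eps ^+ 2 * k%:R) = x ^+ 2 :> R.
  by rewrite /x [RHS]expr2 -expRD; congr expR; field.
pose M := row_mx (- b) A.
pose c i := col i M.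
have cc i : dotp (c i) (c i) = 1.
  rewrite /c /M -(splitK i); case: (fintype.split i) => j /=.
    rewrite colKl [j]ord1 (_ : col 0 (- b) = - b); last first.
      by apply/colP => l; rewrite !mxE.
    by rewrite dotpNl dotpNr opprK -enorm_sqr b1 expr1n.
  by rewrite colKr -enorm_sqr A1 expr1n.
(* Polarization: four times the inner product of [T u] and [T v] is [|T (u + v)|^2 - |T (u - v)|^2].
   A lower tail at the sum and an upper tail at the difference suffice, and the error is exactly
   [eps] because [|u + v|^2 + |u - v|^2 = 4] for unit vectors. *)
pose bad (t : 'I_(1 + n) * 'I_(1 + n) * bool) : set Omega :=
  if t.2 then [set w | (1 + eps) * dotp (c t.1.1 - c t.1.2) (c t.1.1 - c t.1.2) <
    dotp (T w *m (c t.1.1 - c t.1.2)) (T w *m (c t.1.1 - c t.1.2))]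
  else [set w | dotp (T w *m (c t.1.1 + c t.1.2)) (T w *m (c t.1.1 + c t.1.2)) <
    (1 - eps) * dotp (c t.1.1 + c t.1.2) (c t.1.1 + c t.1.2)].
have mbad t : measurable (bad t).
  rewrite /bad; case: ifP => _; apply: measurable_lt_set; try exact: measurable_cst.
    by have [] := concentrated_all (c t.1.1 - c t.1.2) mT cT e0 e1.
  by have [] := concentrated_all (c t.1.1 + c t.1.2) mT cT e0 e1.
have Pbad t : (P (bad t) <= (x ^+ 2)%:E)%E.
  rewrite -x2 /bad; case: ifP => _.
    by have [] := concentrated_all (c t.1.1 - c t.1.2) mT cT e0 e1.
  by have [] := concentrated_all (c t.1.1 + c t.1.2) mT cT e0 e1.
pose ts := enum {: 'I_(1 + n) * 'I_(1 + n) * bool}.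
pose B := \big[setU/set0]_(t <- ts) bad t.
have mB : measurable B by apply: bigsetU_measurable => t _; exact: mbad.
have PB : (P B <= (K * x)%:E)%E.
  apply: le_trans (union_bound ts mbad Pbad) _; rewrite lee_fin.
  rewrite -cardE !card_prod card_bool !card_ord !natrM natrD.
  apply: (@le_trans _ _ ((K * x) ^+ 2)); last first.
    by rewrite expr2 ler_piMr ?mulr_ge0 // ltW.
  rewrite exprMn ler_wpM2r ?sqr_ge0 // /K.
  have -> : (2 * (n%:R + 1) * (n%:R + 2)) ^+ 2 =
    ((1 + n%:R) * (1 + n%:R) * 2) * (2 * (n%:R + 2) ^+ 2) :> R by ring.
  rewrite ler_peMr ?mulr_ge0 ?addr_ge0 //.
  have : 0 <= (n%:R : R) ^+ 2 by exact: sqr_ge0.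
  by rewrite sqrrD; lra.
apply: (@le_trans _ _ (P (~` B))).
  rewrite probability_setC // -(fineK (fin_num_measure P B mB)) -EFinB lee_fin.
  by rewrite lerD2l lerN2 -lee_fin fineK // fin_num_measure.
apply: le_measure; rewrite ?inE //; first exact: measurableC.
move=> w nBw; apply: (not_cone_image nb b1 D0 Dd e0 elt) => i j.
have nbad t : ~ bad t w.
  by move=> bt; apply: nBw; rewrite /B -bigcup_seq; exists t => //=; rewrite mem_enum.
have := nbad (i, j, true); have := nbad (i, j, false); rewrite /bad /=.
move=> /negP; rewrite -leNgt => lo /negP; rewrite -leNgt => up.
move: lo up; rewrite -/(c i) -/(c j) !mulmxDr !mulmxN.
rewrite !(dotpDl, dotpDr, dotpNl, dotpNr) !cc (dotpC (c j)).
rewrite (dotpC (T w *m c j) (T w *m c i)).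
by lra.
Qed.
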